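(* For any $v\in\mathcal{C}^+$, $$\frac{R^{\beta,v}(\mathcal{C}^-)}{\mathbb{E}[R^{\beta,v}(\mathcal{C}^-)]}\to\mathrm{Exp}(1)\ \text{ in distribution, as }\beta\to+\infty,$$ where $\mathrm{Exp}(1)$ denotes the mean $1$ exponential distribution.
   Context: Let $N\geq 3$, $\mathcal{A}=\{1,\dots,N\}$ (actors), $\mathcal{O}=\{-1,+1\}$ (opinions), and let $\beta\geq 0$ be the polarization coefficient. The state space is $$\mathcal{S}=\{u=(u(a):a\in\mathcal{A})\in\mathbb{Z}^N:\ \min\{|u(a)|:a\in\mathcal{A}\}=0\},$$ and $\vec{0}\in\mathcal{S}$ is the null list. For $a\in\mathcal{A}$, $\mathfrak{o}\in\mathcal{O}$ and a list $u$, define $\pi^{a,\mathfrak{o}}(u)(b)=u(b)+\mathfrak{o}$ if $b\neq a$, and $\pi^{a,\mathfrak{o}}(u)(a)=0$. For $u\in\mathcal{S}$, $(U_t^{\beta,u})_{t\in[0,+\infty)}$ is the (non-explosive) Markov jump process on $\mathcal{S}$ started at $U_0^{\beta,u}=u$ which jumps from a list $v$ to $\pi^{a,\mathfrak{o}}(v)$ at rate $\exp(\beta\mathfrak{o}v(a))$, for each $(a,\mathfrak{o})\in\mathcal{A}\times\mathcal{O}$; i.e. its infinitesimal generator is $$\mathcal{G}f(v)=\sum_{\mathfrak{o}\in\mathcal{O}}\sum_{b\in\mathcal{A}}\exp(\beta\mathfrak{o}v(b))\,[f(\pi^{b,\mathfrak{o}}(v))-f(v)]$$ for bounded $f:\mathcal{S}\to\mathbb{R}$.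 Consensus lists: $\mathcal{C}^+=\{u\in\mathcal{S}:u\neq\vec{0},\ u(a)\geq 0\text{ for all }a\in\mathcal{A}\}$ and $\mathcal{C}^-=\{u\in\mathcal{S}:u\neq\vec{0},\ u(a)\leq 0\text{ for all }a\in\mathcal{A}\}$. Hitting times: for $u\in\mathcal{S}$, $B\subset\mathcal{S}$, $R^{\beta,u}(B)=\inf\{t>0:U_t^{\beta,u}\in B\}$. *)

(* Defs.v *)
From HB Require Import structures.
From mathcomp Require Import all_boot all_order all_algebra.
From mathcomp Require Import all_classical all_reals all_analysis.

Set Implicit Arguments.
Unset Strict Implicit.
Unset Printing Implicit Defensive.

Import Order.TTheory GRing.Theory Num.Theory.
Import numFieldNormedType.Exports.

Local Open Scope classical_set_scope.
Local Open Scope ring_scope.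

Definition opinion := bool.
Definition opinion_val (o : opinion) : int := if o then 1 else -1.

(* Actors are numbered from 0. *)
Definition opinion_list (N : nat) := {ffun 'I_N -> int}.

(* The default value of the iterated minimum is the maximum of the |u(a)|, so
   that for N > 0 it plays no role. *)
Definition has_min_abs0 N (u : opinion_list N) : bool :=
  (\big[minn/(\max_(a < N) `|u a|)]_(a < N) `|u a| == 0)%N.

Definition state N := {u : opinion_list N | has_min_abs0 u}.

Definition express N (a : 'I_N) (o : opinion) (u : opinion_list N) :
    opinion_list N :=
  [ffun b => if b == a then 0 else u b + opinion_val o].

Lemma has_min_abs0P N (u : opinion_list N) :
  (0 < N)%N -> reflect (exists a, u a = 0) (has_min_abs0 u).
Proof.
move=> N0; apply: (iffP idP) => [|[a ua]]; last first.
  rewrite /has_min_abs0 -leqn0 -minEnat.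
  have /= := bigmin_le (\max_(b < N) `|u b|)%N a (fun b => `|u b|)%N.
  by rewrite leEnat ua.
have cardN : (0 < #|'I_N|)%N by rewrite card_ord.
have [b0 mE] := bigop.eq_bigmax (fun b : 'I_N => `|u b|%N) cardN.
set m := (\max_(a < N) `|u a|)%N in mE *.
suff [a muE] : exists a, (\big[minn/m]_(a < N) `|u a| = `|u a|)%N.
  by rewrite /has_min_abs0 -/m muE absz_eq0 => /eqP; exists a.
apply: (big_ind (fun x => exists a, x = `|u a|%N)) => [|x y xs ys|a _].
- by exists b0.
- by rewrite /minn; case: ifP.
- by exists a.
Qed.

Lemma express_min_abs0 N a o (u : opinion_list N) :
  has_min_abs0 (express a o u).
Proof.
have N0 : (0 < N)%N := leq_ltn_trans (leq0n a) (ltn_ord a).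
by apply/(has_min_abs0P _ N0); exists a; rewrite ffunE eqxx.
Qed.

Definition express_state N (a : 'I_N) (o : opinion) (v : state N) : state N :=
  exist _ (express a o (val v)) (express_min_abs0 a o (val v)).

Definition consensus_pos N : set (state N) :=
  [set v | val v <> [ffun=> 0] /\ forall a, 0 <= val v a].

Definition consensus_neg N : set (state N) :=
  [set v | val v <> [ffun=> 0] /\ forall a, val v a <= 0].

Definition express_rate (R : realType) N (beta : R) (a : 'I_N) (o : opinion)
    (v : state N) : R :=
  expR (beta * (opinion_val o * val v a)%:~R).

Definition generator (R : realType) N (beta : R) (f : state N -> R)
    (v : state N) : R :=
  \sum_(o : opinion) \sum_(b < N)
    express_rate beta b o v * (f (express_state b o v) - f v).

Section markov_jump_process.
Context {R : realType} {S : countType}.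
Implicit Types (G : (S -> R) -> S -> R) (v w : S).

(* The Q-matrix of a pure jump generator G is q(v, w) = G 1_w v. *)
Definition jump_rate G v w : R := G (fun z => (z == w)%:R) v.
Definition exit_rate G v : R := - jump_rate G v v.
Definition jump_prob G v w : R :=
  if v == w then 0 else jump_rate G v w / exit_rate G v.

(* U is a non-explosive Markov jump process with generator G started at u, in
   the jump chain / holding time sense, for a generator without absorbing
   states: Y is the sequence of visited states and tau the sequence of holding
   times. The last clause says that Y is a Markov chain started at u with
   transition matrix jump_prob G and that, conditionally on Y, the holding times
   are independent, tau i being exponential with rate exit_rate G (Y i). Only
   U t with 0 <= t is meaningful. *)
Definition markov_jump_process G (u : S) d (T : measurableType d)
    (P : probability T R) (U : R -> T -> S) : Prop :=
  exists (Y : nat -> T -> S) (tau : nat -> T -> R),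
    [/\ (forall i y, measurable [set x | Y i x = y]) /\
        (forall i, measurable_fun setT (tau i)),
        forall i x, 0 < tau i x,
        forall x, (\sum_(0 <= i < n) tau i x) @[n --> \oo] --> +oo,
        forall n x t,
          \sum_(0 <= i < n) tau i x <= t < \sum_(0 <= i < n.+1) tau i x ->
          U t x = Y n x &
        forall n (y : nat -> S) (t : nat -> R), (forall i, 0 <= t i) ->
          P [set x | forall i, (i <= n)%N -> Y i x = y i /\ t i < tau i x] =
          ((y 0%N == u)%:R *
           (\prod_(0 <= i < n) jump_prob G (y i) (y i.+1)) *
           \prod_(0 <= i < n.+1) expR (- (exit_rate G (y i) * t i)))%:E].

(* inf set0 = +oo: the value is +oo when B is never hit. *)
Definition hitting_time (T : Type) (U : R -> T -> S) (B : set S) (x : T) :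
    \bar R :=
  ereal_inf [set t%:E | t in [set t : R | 0 < t /\ B (U t x)]].

End markov_jump_process.

(* Convergence in distribution of extended-real random variables X i to a
   probability mu on R: convergence of the distribution functions at every
   continuity point of the limit. The X i may live on different spaces. *)
Definition cvg_in_distribution (R : realType) (I : Type) (F : set_system I)
    (d : I -> measure_display) (T : forall i, measurableType (d i))
    (P : forall i, probability (T i) R) (X : forall i, T i -> \bar R)
    (mu : set R -> \bar R) : Prop :=
  forall r : R, {for r, continuous (fun s : R => mu `]-oo, s]%classic)} ->
    P i [set x | (X i x <= r%:E)%E] @[i --> F] --> mu `]-oo, r]%classic.

Section jump_rates.
Context {R : realType} {N : nat}.
Implicit Types (beta : R) (v w : state N).

Lemma express_state_neq v a o : (1 < N)%N -> express_state a o v != v.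
Proof.
move=> N1; apply/negP => /eqP/(congr1 val)/= /ffunP e.
have /card_gt0P[b ba] : (0 < #|predC1 a|)%N by rewrite cardC1 card_ord -subn1 subn_gt0.
move: (e b); rewrite !ffunE (negbTE ba).
by move/eqP; rewrite -subr_eq0 addrAC subrr add0r; case: o {e}.
Qed.

Lemma jump_rate_generator beta v w : v != w ->
  jump_rate (generator beta) v w =
  \sum_o \sum_(b < N | express_state b o v == w) express_rate beta b o v.
Proof.
move=> /negbTE vw; apply: eq_bigr => o _.
rewrite [RHS]big_mkcond; apply: eq_bigr => b _.
by rewrite vw subr0; case: eqP => _; rewrite ?mulr1 ?mulr0.
Qed.

Lemma exit_rate_generator beta v : (1 < N)%N ->
  exit_rate (generator beta) v = \sum_o \sum_(b < N) express_rate beta b o v.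
Proof.
move=> N1; rewrite /exit_rate /jump_rate /generator -sumrN.
apply: eq_bigr => o _; rewrite -sumrN; apply: eq_bigr => b _.
by rewrite (negbTE (express_state_neq _ _ _ N1)) eqxx sub0r mulrN1 opprK.
Qed.

End jump_rates.

(* Main.v *)
Require Import Defs.
From mathcomp Require Import all_boot all_order all_algebra.
From mathcomp Require Import fingroup perm polyrcf.
From mathcomp Require Import all_classical all_reals all_analysis.
From mathcomp Require Import measurable_realfun.
From mathcomp Require Import ring lra zify.

Set Implicit Arguments.
Unset Strict Implicit.
Unset Printing Implicit Defensive.

Import Order.TTheory GRing.Theory Num.Theory.
Import numFieldNormedType.Exports.

Local Open Scope classical_set_scope.
Local Open Scope ring_scope.

(** Call ladder a list whose entries are [0, 1, .., N - 1] in some order, write [C]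
    for the negative consensus and [target] for the union of the ladders and [C].
    All ladders are the same up to renaming the actors, so that what the process
    does after reaching one does not depend on which. The hitting time of [C] is
    therefore a sum of independent attempts, each of which fails by coming back
    to a ladder, and it is close to an exponential variable because an attempt
    is short compared to the mean [m] of the whole. Two facts express this.

    - From any list, letting the actor of largest pressure follow its sign leads
      to [target] in a number of steps that depends on [N] only, and each of these
      moves has probability at least [1 / (2 N)] since no other has a larger rate
      ([reach_target], [target_fading]). Total rates being at least [1], [target] is
      reached in mean time at most [target_bound], a constant of [N] alone.
    - From a ladder, the moves of opinion [-1] of the actors above [0] have rate at
      most [exp (- beta)]. The actor at [0] expresses [-1] at rate [1], which keeps
      the list a positive consensus; another such move has to come before those of
      opinion [+1], of rate at least [exp beta], restore the situation. The function
      [escape] measures this: it is small on the positive consensus, is [1] outside,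
      and on the former its drift is at most of order [exp (- beta)]
      ([escape_drift]). Thus [m] is at least of order [exp beta], and a positive
      consensus reaches the ladders before [C] with probability close to [1]
      ([neg_time_lower], [neg_first_small]).

    Let [psi] be the Laplace transform at [theta] of the hitting time of [C]. Then
    [1 - psi] is [theta] times the expected integral of [psi] along the trajectory
    up to [C]. Along the trajectory [psi] is close to its value [psi l] at a ladder
    [l], except in the risky states, those from which [C] has a sizable probability
    to come before the ladders; they contribute little, as few visits to them can
    be survived ([risky_time_le]). So [1 - psi l] is nearly [theta * m * psi l]
    ([laplace_defect_ge], [laplace_defect_le]). With [theta = lam / E T], where
    [E T] is the mean from the initial list and is equivalent to [m], the limit is
    [1 / (1 + lam)] ([cvg_neg_laplace]). All these comparisons are instances of a
    maximum principle for killed chains ([maximum_principle]), the functions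
    involved being defined as Green functions of the jump chain ([green]).

    The link with the given processes is made by computing, from the joint law of
    the visited states and of the tails of the holding times, the mean and the
    Laplace transform of the hitting time ([integral_chain],
    [expectation_hitting_time], [laplace_hitting_time]).

    Finally, if [X] is the normalized hitting time, the limits of the Laplace
    transforms at the integers say that the moments of [exp (- X)] tend to those
    of the uniform law on [0, 1]. A law on [0, 1] is controlled by its moments
    ([cdf_of_moments]), so [exp (- X)] tends in law to a uniform variable and [X] to
    an exponential one. *)

(** * Killed finitely branching Markov chains *)

Section killed_chain.
Context {R : realType} {S : Type} {I : finType}.
Variables (p : S -> I -> R) (nxt : S -> I -> S).
Implicit Types (c f g b : S -> R) (u : S).

Definition avg f u : R := \sum_(i : I) p u i * f (nxt u i).

(** The factor [c u] is a survival probability: an indicator kills the chain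
    outside a set, while [q / (q + theta)] makes it race, at a state of exit rate
    [q], against an exponential clock of rate [theta]. *)
Definition kill c f u : R := c u * avg f u.

Hypothesis p_ge0 : forall u i, 0 <= p u i.
Hypothesis p_sum1 : forall u, \sum_i p u i = 1.

Lemma avg_cst a u : avg (fun=> a) u = a.
Proof. by rewrite /avg -mulr_suml p_sum1 mul1r. Qed.

Lemma avgD f g u : avg (fun w => f w + g w) u = avg f u + avg g u.
Proof. by rewrite /avg -big_split; apply: eq_bigr => i _; rewrite mulrDr. Qed.

Lemma avgB f g u : avg (fun w => f w - g w) u = avg f u - avg g u.
Proof. by rewrite /avg -sumrB; apply: eq_bigr => i _; rewrite mulrBr. Qed.

Lemma avgZ a f u : avg (fun w => a * f w) u = a * avg f u.
Proof. by rewrite /avg mulr_sumr; apply: eq_bigr => i _; rewrite mulrCA. Qed.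

Lemma ler_avg f g u : (forall w, f w <= g w) -> avg f u <= avg g u.
Proof. by move=> fg; apply: ler_sum => i _; rewrite ler_wpM2l. Qed.

Lemma avg_le f u a : (forall w, f w <= a) -> avg f u <= a.
Proof. by move=> fa; rewrite -(avg_cst a u); exact: ler_avg. Qed.

Lemma avg_ge f u a : (forall w, a <= f w) -> a <= avg f u.
Proof. by move=> fa; rewrite -(avg_cst a u); exact: ler_avg. Qed.

Section kill.
Variable c : S -> R.
Hypothesis c01 : forall u, 0 <= c u <= 1.

Let c_ge0 u : 0 <= c u. Proof. by case/andP: (c01 u). Qed.
Let c_le1 u : c u <= 1. Proof. by case/andP: (c01 u). Qed.

Lemma ler_kill f g u : (forall w, f w <= g w) -> kill c f u <= kill c g u.
Proof. by move=> fg; rewrite ler_wpM2l// ler_avg. Qed.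

Lemma ler_iter_kill n f g u :
  (forall w, f w <= g w) -> iter n (kill c) f u <= iter n (kill c) g u.
Proof. by move=> fg; elim: n u => //= n IH u; exact: ler_kill. Qed.

Lemma iter_killZ n a f u :
  iter n (kill c) (fun w => a * f w) u = a * iter n (kill c) f u.
Proof.
elim: n u => //= n IH u; rewrite /kill (_ : avg _ u = avg (fun w => a * iter n (kill c) f w) u).
  by rewrite avgZ mulrCA.
by apply: eq_bigr => i _; rewrite IH.
Qed.

Lemma iter_kill_ge0 n f u : (forall w, 0 <= f w) -> 0 <= iter n (kill c) f u.
Proof.
by move=> f0; elim: n u => //= n IH u; rewrite mulr_ge0// avg_ge.
Qed.

Lemma iter_kill_le n f a u : 0 <= a ->
  (forall w, f w <= a) -> iter n (kill c) f u <= a.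
Proof.
move=> a0 fa; elim: n u => //= n IH u; rewrite /kill.
apply: (@le_trans _ _ (c u * a)); first by rewrite ler_wpM2l// avg_le.
by rewrite ler_piMl.
Qed.

End kill.

Lemma ler_iter_kill_coef c c' n f u : (forall w, 0 <= c w <= c' w) ->
  (forall w, 0 <= f w) -> iter n (kill c) f u <= iter n (kill c') f u.
Proof.
move=> cc' f0; suff : 0 <= iter n (kill c) f u <= iter n (kill c') f u by case/andP.
elim: n u => [|n IH] u /=; first by rewrite f0 lexx.
have /andP[c0 cc] := cc' u.
rewrite /kill mulr_ge0 ?avg_ge//=; last by move=> w; case/andP: (IH w).
apply: ler_pM => //; first by apply: avg_ge => w; case/andP: (IH w).
by apply: ler_avg => w; case/andP: (IH w).
Qed.

(** Uniform transience: the condition under which the linear equations attached to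
    the killed chain are well posed among bounded functions. *)
Definition fading c n rho :=
  rho < 1 /\ forall u, iter n (kill c) (fun=> 1) u <= rho.

Lemma fadingW c c' n rho : (forall w, 0 <= c w <= c' w) ->
  fading c' n rho -> fading c n rho.
Proof.
move=> cc' [r1 h]; split=> // u; apply: le_trans (h u).
by apply: ler_iter_kill_coef.
Qed.

(** Over [n] steps, [f] is at most its supremum times the survival probability,
    which is at most [rho < 1]; so the supremum cannot be positive. *)
Lemma subsolution_le0 c n rho f M : (forall u, 0 <= c u <= 1) ->
  fading c n rho -> (forall u, f u <= M) ->
  (forall u, f u <= kill c f u) -> forall u, f u <= 0.
Proof.
move=> c01 [rho1 hrho] fM fK u.
have fKn k w : f w <= iter k (kill c) f w.
  elim: k w => //= k IH w; apply: (le_trans (fK w)); exact: ler_kill.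
set s := sup (range f).
have hs : has_sup (range f).
  by split; [exists (f u), u | exists M => _ [w _ <-]].
have fs w : f w <= s by apply: (ub_le_sup (proj2 hs)); exists w.
apply: (le_trans (fs u)); rewrite leNgt; apply/negP => s0.
suff : s <= s * rho by rewrite leNgt gtr_pMr// rho1.
apply: (ge_sup (proj1 hs)) => _ [w _ <-].
apply: (le_trans (fKn n w)).
apply: (@le_trans _ _ (iter n (kill c) (fun w => s * 1) w)).
  by apply: ler_iter_kill => // z; rewrite mulr1.
by rewrite iter_killZ ler_wpM2l ?(ltW s0).
Qed.

(** Green operator: the expected total of [b] along the killed chain. *)
Definition green c b u : R := limn (series (fun k => iter k (kill c) b u)).

Section green.
Variables (c b : S -> R) (n : nat) (rho beta : R).
Hypothesis c01 : forall u, 0 <= c u <= 1.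
Hypothesis cfade : fading c n rho.
Hypothesis b0 : forall u, 0 <= b u.
Hypothesis bB : forall u, b u <= beta.

Let P k u := series (fun k => iter k (kill c) b u) k.

Let PS k u : P k.+1 u = b u + kill c (P k) u.
Proof.
rewrite /P /series /= big_nat_recl//=; congr (_ + _).
rewrite /kill /avg mulr_sumr.
under [RHS]eq_bigr do rewrite mulr_sumr mulr_sumr.
rewrite exchange_big/=; apply: eq_bigr => i _.
by rewrite mulr_sumr.
Qed.

Let beta0 u : 0 <= beta. Proof. exact: le_trans (b0 u) (bB u). Qed.

Let P_ge0 k u : 0 <= P k u.
Proof. by apply: sumr_ge0 => i _; exact: iter_kill_ge0. Qed.

Let PDn l j u : P (l + j) u = P l u + iter l (kill c) (P j) u.
Proof.
elim: l u => [|l IH] u; first by rewrite /= (_ : P 0 u = 0) ?add0r// /P /series /= big_geq.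
rewrite addSn !PS /= -addrA; congr (_ + _).
rewrite /kill -mulrDr -avgD; congr (_ * _); apply: eq_bigr => i _.
by rewrite IH.
Qed.

Let P_ub k u : P k u <= n%:R * beta / (1 - rho).
Proof.
case: (cfade) => rho1 hrho.
have r0 : 0 < 1 - rho by rewrite subr_gt0.
have nb (w : S) : 0 <= n%:R * beta / (1 - rho).
  by apply: divr_ge0; [apply: mulr_ge0; [exact: ler0n|exact: beta0 w]|exact: ltW].
have [m] := ubnP k; elim: m k u => // m IH k u; rewrite ltnS => km.
(* Over n steps the reward is at most n * beta; what comes later is at most rho
   times the bound to be proved. *)
have short j w : (j <= n)%N -> P j w <= n%:R * beta.
  move=> jn; apply: (@le_trans _ _ (\sum_(0 <= i < j) beta)).
    by apply: ler_sum => i _; exact: iter_kill_le (beta0 w) _.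
  by rewrite sumr_const_nat subn0 -[beta *+ j]mulr_natl ler_wpM2r ?(beta0 w)// ler_nat.
have [kn|nk] := leqP k n.
  apply: (le_trans (short _ _ kn)).
  rewrite ler_pdivlMr// ler_piMr ?mulr_ge0 ?(beta0 u)//.
  rewrite gerBl; have := hrho u; apply: le_trans; apply: iter_kill_ge0 => //.
have -> : P k u = P n u + iter n (kill c) (P (k - n)) u.
  by rewrite -PDn subnKC// ltnW.
have [n0|n0] := posnP n.
  by have := hrho u; rewrite n0 /= leNgt rho1.
have kn : (k - n < m)%N by apply: leq_trans km; rewrite ltn_subrL n0 (leq_trans _ nk).
apply: (@le_trans _ _ (n%:R * beta + (n%:R * beta / (1 - rho)) * rho)).
  apply: lerD; first exact: short.
  apply: (@le_trans _ _ (iter n (kill c) (fun w => (n%:R * beta / (1 - rho)) * 1) u)).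
    by apply: ler_iter_kill => // w; rewrite mulr1 IH.
  by rewrite iter_killZ ler_wpM2l ?(nb u).
rewrite le_eqVlt; apply/orP; left; apply/eqP; by field; rewrite gt_eqF.
Qed.

Lemma cvg_green u : series (fun k => iter k (kill c) b u) @ \oo --> green c b u.
Proof.
apply: nondecreasing_is_cvgn.
  apply: nondecreasing_series => k _ _; exact: iter_kill_ge0.
exists (n%:R * beta / (1 - rho)) => _ [k _ <-]; exact: P_ub.
Qed.

Lemma green_ge0 u : 0 <= green c b u.
Proof.
apply: limr_ge; first exact: cvg_green.
by near=> k; exact: P_ge0.
Unshelve. all: by end_near. Qed.

Lemma green_le u : green c b u <= n%:R * beta / (1 - rho).
Proof.
apply: limr_le; first exact: cvg_green.
by near=> k; exact: P_ub.
Unshelve. all: by end_near. Qed.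

Lemma greenE u : green c b u = b u + kill c (green c b) u.
Proof.
have h : (fun k => P k.+1 u) @ \oo --> b u + kill c (green c b) u.
  rewrite (_ : (fun k => _) = (fun k => b u + kill c (P k) u)); last first.
    by apply/funext => k; rewrite PS.
  apply: cvgD; first exact: cvg_cst.
  apply: cvgM; first exact: cvg_cst.
  rewrite /avg; apply: cvg_big => [|i _]; first exact: add_continuous.
  by apply: cvgM; [exact: cvg_cst|exact: cvg_green].
apply: (cvg_unique _ _ h) => //.
by have := @cvg_green u; rewrite -cvg_shiftS.
Qed.

End green.

(** The positive part of [f] is a subsolution for the chain killed outside [D].
    The condition [0 < f u] is what allows one to compare with functions that
    satisfy an equation with discount. *)
Lemma maximum_principle (D : set S) n rho f M : fading \1_D n rho ->
  (forall u, f u <= M) -> (forall u, D u -> 0 < f u -> f u <= avg f u) ->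
  (forall u, ~ D u -> f u <= 0) -> forall u, f u <= 0.
Proof.
move=> Df fM fD fND u.
suff : Num.max 0 (f u) <= 0 by rewrite ge_max => /andP[].
move: u; apply: (subsolution_le0 (M := Num.max 0 M) _ Df) => u.
- by rewrite indicE; case: (u \in D); rewrite ?lexx ?ler01.
- by rewrite ge_max !le_max lexx/= fM orbT.
have f0 : 0 <= avg (fun w => Num.max 0 (f w)) u.
  by apply: avg_ge => w; rewrite le_max lexx.
rewrite /kill indicE; have [uD|uD] := boolP (u \in D).
  rewrite mul1r ge_max f0/=; have [fu|fu] := leP (f u) 0; first exact: le_trans f0.
  apply: le_trans (fD _ (set_mem uD) fu) _; apply: ler_avg => w.
  by rewrite le_max lexx orbT.
rewrite mul0r ge_max lexx/=; apply: fND; by move/negP: uD => + Du; apply; exact: mem_set.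
Qed.

Section reachability.
Variable step : S -> S -> Prop.
Implicit Types A B : set S.

Fixpoint reach A k u : Prop :=
  A u \/ if k is k'.+1 then exists2 w, step u w & reach A k' w else False.

Lemma reachW A k l u : (k <= l)%N -> reach A k u -> reach A l u.
Proof.
elim: k l u => [|k IH] [|l] u //= kl; first by case=> // Au; left.
by case=> [Au|[w uw kw]]; [left|right; exists w => //; exact: IH kw].
Qed.

Lemma reach_trans A B k l u :
  (forall w, A w -> reach B l w) -> reach A k u -> reach B (k + l) u.
Proof.
move=> AB; elim: k u => [|k IH] u.
  by case=> [/AB|//].
case=> [Au|[w uw kw]]; first by apply: (@reachW B l) (AB _ Au); rewrite leq_addl.
by right; exists w => //; exact: IH.
Qed.

(** The first step of the path is taken with probability at least [delta], and all
    the other steps survive with probability at most [1]. *)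
Lemma reach_fading A delta k : 0 <= delta <= 1 ->
  (forall u w, step u w -> exists2 i, w = nxt u i & delta <= p u i) ->
  forall u, reach A k u ->
    iter k.+1 (kill \1_(~` A)) (fun=> 1) u <= 1 - delta ^+ k.
Proof.
move=> /andP[d0 d1] stepP.
have I01 u : 0 <= (\1_(~` A) u : R) <= 1.
  by rewrite indicE; case: (_ \in _); rewrite ?lexx ?ler01.
have killA j u : A u -> iter j.+1 (kill \1_(~` A)) (fun=> 1) u = 0.
  by move=> Au; rewrite /= /kill indicE memNset ?mul0r// => /(_ Au).
have dk1 j : delta ^+ j <= 1 by exact: exprn_ile1.
elim: k => [|k IH] u.
  by rewrite expr0 subrr => -[Au|//]; rewrite killA.
case=> [Au|[_ /stepP[i -> di] kw]]; first by rewrite killA// subr_ge0.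
set f := iter k.+1 _ _ in IH.
have f1 w : f w <= 1 by exact: iter_kill_le.
have f0 w : 0 <= f w by exact: iter_kill_ge0.
apply: (@le_trans _ _ (avg f u)).
  rewrite iterS -/f /kill; apply: ler_piMl; first exact: avg_ge.
  by case/andP: (I01 u).
apply: (@le_trans _ _ (p u i * (1 - delta ^+ k) + (1 - p u i))).
  rewrite /avg (bigD1 i)//= lerD ?ler_wpM2l ?IH//.
  have -> : 1 - p u i = \sum_(j | j != i) p u j.
    by apply/eqP; rewrite subr_eq addrC -(p_sum1 u) (bigD1 i).
  by apply: ler_sum => j _; rewrite ler_piMr.
rewrite mulrBr mulr1 addrC addrA subrK lerD2l lerN2 exprS.
by rewrite ler_wpM2r// exprn_ge0.
Qed.

End reachability.

End killed_chain.

Lemma sub_reach {S : Type} (step step' : S -> S -> Prop) (A : set S) k u :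
  (forall v w, step v w -> step' v w) -> reach step A k u -> reach step' A k u.
Proof.
move=> ss; elim: k u => [|k IH] u; first by case=> // ?; left.
case=> [Au|[w uw kw]]; first by left.
by right; exists w; [exact: ss|exact: IH].
Qed.

(** * Loudest-actor paths *)

Section loud_paths.
Variable N : nat.
Implicit Types (u w : state N) (a b : 'I_N) (o : opinion).

Lemma val_express a o u b :
  val (express_state a o u) b = if b == a then 0 else val u b + opinion_val o.
Proof. by rewrite ffunE. Qed.

(** An actor of maximal pressure follows its sign: these are the moves of maximal
    rate, whatever [beta >= 0]. *)
Definition loud u w := exists a o, w = express_state a o u /\
  forall b, `|val u b| <= opinion_val o * val u a.

Lemma exists_loud u : (0 < N)%N ->
  exists a o, forall b, `|val u b| <= opinion_val o * val u a.
Proof.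
move=> N0; pose a := [arg max_(b > Ordinal N0) `|val u b|%N].
have am b : (`|val u b| <= `|val u a|)%N.
  by rewrite /a; case: arg_maxnP => // i _; apply.
exists a; exists (0 <= val u a) => b; move: (am b).
by rewrite /opinion_val; case: ifP; lia.
Qed.

Definition all_ge0 : set (state N) := [set u : state N | forall a, 0 <= val u a].
Definition all_le0 : set (state N) := [set u : state N | forall a, val u a <= 0].
Definition bounded_by (k : nat) : set (state N) :=
  [set u : state N | forall a, `|val u a| <= k%:Z].

(** Loud moves permute these lists among themselves: they are the metastable
    states of the positive side. *)
Definition ladder : set (state N) :=
  [set u : state N | exists2 f : 'I_N -> 'I_N, injective f & forall a, val u a = (f a : nat)%:Z].

Let outside (E : {set 'I_N}) : #|E| != N -> exists a, a \notin E.
Proof.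
move=> EN; apply/existsP; rewrite -negb_forall; apply: contraNN EN => /forallP h.
by rewrite (_ : E = finset.setT) ?cardsT ?card_ord//; apply/setP => a; rewrite inE h.
Qed.

Let all_in (E : {set 'I_N}) : (#|E| + 0 = N)%N -> forall a, a \in E.
Proof.
move=> EN a; apply: contraT => aE; have := subset_leq_card (finset.subsetT (a |: E)).
by rewrite cardsU1 aE cardsT card_ord add1n -[X in (X.+1 <= _)%N]addn0 EN ltnn.
Qed.

(** The set [E] collects the actors that have spoken. As each step adds one actor to
    [E] and changes a pressure by at most [1], those of [E] stay below [#|E|]. If the
    loudest actor is one of them, everybody is below [#|E|]. *)
Lemma reach_bounded_spoken u k (E : {set 'I_N}) : (0 < N)%N -> (#|E| + k = N)%N ->
  (forall a, a \in E -> `|val u a| <= #|E|%:Z) -> reach loud (bounded_by N) k u.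
Proof.
move=> N0; elim: k u E => [|k IH] u E Ek hE.
  left=> a; move: (hE _ (all_in Ek a)) (Ek); lia.
have [a [ o ao]] := exists_loud u N0.
have [aE|aE] := boolP (a \in E).
  left=> b; move: (hE _ aE) (ao b) Ek; rewrite /opinion_val; case: o {ao}; lia.
right; exists (express_state a o u); first by exists a, o.
apply: (IH _ (a |: E)); first by rewrite cardsU1 aE add1n; lia.
move=> b; rewrite cardsU1 aE add1n val_express !inE; case: eqP => [_ _|_ bE]; first by rewrite normr0.
by move: (hE _ bE); rewrite /opinion_val; case: o {ao}; lia.
Qed.

Lemma reach_bounded u : (0 < N)%N -> reach loud (bounded_by N) N u.
Proof.
by move=> N0; apply: (@reach_bounded_spoken u N finset.set0) => // [|a]; rewrite ?cards0 ?inE.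
Qed.

(** Seen from [o], a move for [o] raises a pressure of [-1] to [0]. *)
Lemma express_all_ge0 a u o : (forall b, 0 <= opinion_val o * val u b + 1) ->
  forall b, 0 <= opinion_val o * val (express_state a o u) b.
Proof.
move=> h b; rewrite val_express; case: eqP => [_|_]; first by rewrite mulr0.
by move: (h b); rewrite /opinion_val; case: o {h}; lia.
Qed.

(** Seen from the opinion [o], all pressures lie in the window from [-y] to [x]. A
    loud move for [o] shifts the other actors by one and drops an extreme actor
    strictly inside the window. So either an end loses an actor, or the window
    can be shortened, until it has no room left on one side of [0]. The factor
    [N + 1] makes the second case decrease the weight, as there are at most [N]
    actors at the ends. *)
Definition window_ends o (x y : nat) u : {set 'I_N} :=
  [set a | (opinion_val o * val u a == x%:Z) ||
           (opinion_val o * val u a == - y%:Z)]%SET.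

Definition window_weight o (x y : nat) u : nat :=
  ((x + y) * N.+1 + #|window_ends o x y u|)%N.

Lemma reach_consensus_window m o (x y : nat) u : (0 < N)%N ->
  (window_weight o x y u < m)%N ->
  (forall a, - y%:Z <= opinion_val o * val u a <= x%:Z) ->
  reach loud (all_ge0 `|` all_le0) m u.
Proof.
move=> N0; elim: m o x y u => // m IH o x y u; rewrite ltnS => wm hu.
have ovE : opinion_val o = 1 \/ opinion_val o = -1 by case: o {wm hu}; [left|right].
have cons w o' : (forall b, 0 <= opinion_val o' * val w b) -> (all_ge0 `|` all_le0) w.
  by case: o' => h; [left|right] => b; move: (h b); rewrite /opinion_val; lia.
have [a [ o' ao]] := exists_loud u N0.
(* Exchanging the two opinions exchanges x and y, so o may be the opinion that is
   about to be expressed. *)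
wlog oo' : o x y wm hu ovE / o = o'.
  move=> wl; have [|oo'] := eqVneq o o'; first exact: (wl o x y wm hu ovE).
  have E : opinion_val o' = - opinion_val o by move: oo'; case: (o); case: (o').
  apply: (wl o' y x) => //.
  - rewrite (leq_trans _ wm)// /window_weight [(y + x)%N]addnC leq_add2l.
    apply/subset_leq_card/fintype.subsetP => b; rewrite !inE E; lia.
  - by move=> b; move: (hu b); rewrite E; lia.
  - by rewrite E; case: ovE => ->; [right|left].
subst o'; have [/existsP[b bP]|/existsPn nb] := boolP [exists b, opinion_val o * val u b < -1].
  right; exists (express_state a o u); first by exists a, o.
  have sgn b' : b' != a -> opinion_val o * val (express_state a o u) b' = opinion_val o * val u b' + 1.
    by rewrite val_express => /negbTE->; case: ovE => ->; lia.
  have valE : val (express_state a o u) a = 0 by rewrite val_express eqxx.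
  have hb := hu b.
  have [xM|Mx] := eqVneq (opinion_val o * val u a) x%:Z.
    apply: (IH o x.+1 y.-1).
      apply: (leq_trans _ wm); rewrite /window_weight.
      rewrite (_ : x.+1 + y.-1 = x + y)%N; last by lia.
      rewrite ltn_add2l; apply: proper_card; apply/fintype.properP; split.
        apply/fintype.subsetP => b'; rewrite !inE; case: (eqVneq b' a) => [->|/sgn->].
          by rewrite valE mulr0; lia.
        by lia.
      exists a; rewrite !inE ?xM ?eqxx// valE mulr0; lia.
    move=> b'; have := hu b'; case: (eqVneq b' a) => [->|/sgn->]; last by lia.
    by rewrite valE mulr0; lia.
  apply: (IH o x y.-1).
    apply: (leq_trans _ wm); rewrite /window_weight.
    rewrite (_ : x + y = (x + y.-1).+1)%N; last by lia.
    apply: (@leq_trans ((x + y.-1) * N.+1 + N).+1); last first.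
      by rewrite mulSn -addnS addnC leq_addr.
    by rewrite ltnS leq_add2l -[X in (_ <= X)%N]card_ord max_card.
  move=> b'; have := hu b'; have := ao b'; have := hu a.
  case: (eqVneq b' a) => [->|/sgn->]; first by rewrite valE mulr0; lia.
  by case: ovE Mx => ->; lia.
right; exists (express_state a o u); first by exists a, o.
apply: (@reachW _ _ _ 0) => //; left; apply: (cons _ o) => b.
by apply: express_all_ge0 => b'; move: (nb b'); lia.
Qed.

(** When nobody is negative, every step raises the silent actors by one. Those who
    have spoken, the elements of [E], thus stay below the others: each actor speaks
    once before any speaks twice, and the speakers fill [0, .., #|E| - 1]. *)
Lemma reach_ladder_spoken u k (E : {set 'I_N}) : (0 < N)%N -> (#|E| + k = N)%N ->
  {in E &, injective (val u)} -> (forall a, a \in E -> 0 <= val u a < #|E|%:Z) ->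
  (forall a, a \notin E -> #|E|%:Z <= val u a) -> reach loud ladder k u.
Proof.
move=> N0; elim: k u E => [|k IH] u E Ek inj hE hEC.
  have inE := all_in Ek.
  have uN a : (`|val u a| < N)%N by move: (hE _ (inE a)) Ek; lia.
  left; exists (fun a => Ordinal (uN a)) => [a b [e]|a].
    have {}e : (`|val u a| = `|val u b|)%N := e.
    by apply: inj => //; move: (hE _ (inE a)) (hE _ (inE b)); lia.
  by rewrite (_ : nat_of_ord _ = `|val u a|%N)//; move: (hE _ (inE a)); lia.
have [a [ o ao]] := exists_loud u N0.
have u0 b : 0 <= val u b.
  by have [bE|bE] := boolP (b \in E); [move: (hE _ bE)|move: (hEC _ bE)]; lia.
have am b : `|val u b| <= val u a by move: (ao b) (u0 a); rewrite /opinion_val; case: o {ao}; lia.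
have [z zE] : exists a, a \notin E by apply: outside; move: (Ek); lia.
have aE : a \notin E.
  by apply/negP => /hE; move: (hEC _ zE) (am z); lia.
right; exists (express_state a true u); first by exists a, true; split=> // b; rewrite mul1r.
have vE b : b != a -> val (express_state a true u) b = val u b + 1.
  by rewrite val_express => /negbTE->.
have va : val (express_state a true u) a = 0 by rewrite val_express eqxx.
have nEa b : b \in E -> b != a by apply: contraTneq => ->.
apply: (IH _ (a |: E)).
- by rewrite cardsU1 aE add1n; lia.
- move=> b c /finset.setU1P[->|bE] /finset.setU1P[->|cE] //; rewrite ?va ?vE ?nEa//.
  + by move: (hE _ cE); lia.
  + by move: (hE _ bE); lia.
  + by move=> /addIr; exact: inj.
- move=> b; rewrite cardsU1 aE add1n => /finset.setU1P[->|bE]; rewrite ?va ?vE ?nEa//.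
  by move: (hE _ bE); lia.
- move=> b; rewrite cardsU1 aE add1n !inE negb_or => /andP[ba bE]; rewrite vE//.
  by move: (hEC _ bE); lia.
Qed.

Lemma reach_ladder u : (0 < N)%N -> all_ge0 u -> reach loud ladder N u.
Proof.
move=> N0 u0; apply: (@reach_ladder_spoken u N finset.set0) => //.
- by rewrite cards0.
- by move=> a b; rewrite inE.
- by move=> a; rewrite inE.
- by move=> a; rewrite cards0.
Qed.

Lemma all_le0P u : all_le0 u -> all_ge0 u \/ consensus_neg u.
Proof.
move=> u0; have [/eqP uz|un] := boolP (val u == [ffun=> 0]); last first.
  by right; split; [exact/eqP|].
by left=> a; rewrite uz ffunE.
Qed.

(** The three terms bound the number of steps to a bounded list, from there to a
    list without disagreement, and from there to a ladder. *)
Definition loud_steps : nat := (N + ((N + N) * N.+1 + N).+1 + N)%N.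

Lemma reach_target u : (0 < N)%N ->
  reach loud (ladder `|` @consensus_neg N) loud_steps u.
Proof.
move=> N0; rewrite /loud_steps -addnA; apply: reach_trans (reach_bounded u N0).
move=> {}u uN; apply: (@reach_trans _ _ (all_ge0 `|` all_le0)); last first.
  apply: (@reach_consensus_window _ true N N) => // [|a].
    by rewrite ltnS leq_add2l -[X in (_ <= X)%N]card_ord max_card.
  by move: (uN a); rewrite mul1r; lia.
have ge0 w : all_ge0 w -> reach loud (ladder `|` @consensus_neg N) N w.
  move=> w0; rewrite -[X in reach _ _ X]addn0.
  by apply: reach_trans (reach_ladder N0 w0) => z zL; left; left.
move=> w [|/all_le0P[]]; [exact: ge0|exact: ge0|].
by move=> wC; apply: (@reachW _ _ _ 0) => //; left; right.
Qed.

(** Among lists bounded by [B] every move has a probability bounded below, though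
    not uniformly in [beta]. *)
Definition bounded_step (B : nat) u w :=
  (exists a o, w = express_state a o u) /\ bounded_by B u.

(** An actor that has expressed [-1] is only pushed down by the later
    speakers; [E] is the set of the actors that have spoken. *)
Lemma reach_neg_spoken B m k u (E : {set 'I_N}) : (1 < N)%N ->
  (#|E| + k.+1 = N)%N -> (m + k <= B)%N -> bounded_by m u ->
  (forall a, a \in E -> val u a <= 0) ->
  reach (bounded_step B) (@consensus_neg N) k.+1 u.
Proof.
move=> N1; elim: k m u E => [|k IH] m u E Ek mB um hE;
  have [a aE] : exists a, a \notin E by [apply: outside; move: (Ek); lia].
- right; exists (express_state a false u).
    by split; [exists a, false|move=> b; apply: le_trans (um b) _; rewrite lez_nat; lia].
  have bE b : b != a -> b \in E.
    move=> ba; have : (#|a |: E| + 0 = N)%N by rewrite cardsU1 aE add1n addn0 -addn1.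
    by move=> /all_in/(_ b); rewrite !inE (negbTE ba).
  left; split=> [/ffunP h|b]; last first.
    rewrite val_express; case: eqP => // /eqP ba; move: (hE _ (bE _ ba)).
    by rewrite /opinion_val; lia.
  have /card_gt0P[b ba] : (0 < #|predC1 a|)%N by rewrite cardC1 card_ord -subn1 subn_gt0.
  move: (h b); rewrite val_express (negbTE ba) ffunE.
  by move: (hE _ (bE _ ba)); rewrite /opinion_val; lia.
- right; exists (express_state a false u).
    by split; [exists a, false|move=> b; apply: le_trans (um b) _; rewrite lez_nat; lia].
  apply: (IH m.+1 _ (a |: E)).
  + by rewrite cardsU1 aE; lia.
  + by lia.
  + move=> b; rewrite val_express; case: eqP => [_|_]; first by rewrite normr0.
    by move: (um b); rewrite /opinion_val; lia.
  + move=> b /finset.setU1P[->|bE]; rewrite val_express; first by rewrite eqxx.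
    by case: eqP => // _; move: (hE _ bE); rewrite /opinion_val; lia.
Qed.

Lemma reach_neg u : (1 < N)%N -> (ladder `|` @consensus_neg N) u ->
  reach (bounded_step (N + N)) (@consensus_neg N) N u.
Proof.
move=> N1 [[f _ fu]|uC]; last by apply: (@reachW _ _ _ 0) => //; left.
have uN : bounded_by N u by move=> a; rewrite fu; have := ltn_ord (f a); lia.
apply: (@reachW _ _ _ N.-1.+1); first by lia.
apply: (@reach_neg_spoken _ N N.-1 u finset.set0) => //.
- by rewrite cards0; lia.
- by lia.
- by move=> a; rewrite inE.
Qed.

End loud_paths.

(** * The jump chain of the opinion model *)

Section opinion_chain.
Context {R : realType} {N : nat}.
Implicit Types (beta : R) (u w : state N) (i : opinion * 'I_N).

Definition speak u i : state N := express_state i.2 i.1 u.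
Definition move_rate beta u i : R := express_rate beta i.2 i.1 u.
Definition total_rate beta u : R := \sum_i move_rate beta u i.
Definition move_prob beta u i : R := move_rate beta u i / total_rate beta u.

Lemma sum_moves (V : nmodType) (F : opinion * 'I_N -> V) :
  \sum_i F i = \sum_a F (true, a) + \sum_a F (false, a).
Proof.
rewrite (eq_bigr (fun i => F (i.1, i.2))) => [|[]//].
by rewrite -(pair_bigA _ (fun o a => F (o, a)))/= big_bool.
Qed.

Lemma move_rate_gt0 beta u i : 0 < move_rate beta u i.
Proof. exact: expR_gt0. Qed.

Section rates.
Variable beta : R.
Hypotheses (N_ge3 : (3 <= N)%N) (beta_ge0 : 0 <= beta).

Lemma ler_move_rate u i i' :
  opinion_val i.1 * val u i.2 <= opinion_val i'.1 * val u i'.2 ->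
  move_rate beta u i <= move_rate beta u i'.
Proof. by move=> h; rewrite ler_expR ler_wpM2l// ler_int. Qed.

Lemma total_rate_ge1 u : 1 <= total_rate beta u.
Proof.
have N0 : (0 < N)%N by apply: leq_trans N_ge3.
have [a [ o ao]] := exists_loud u N0.
rewrite /total_rate (bigD1 (o, a))//=.
rewrite (@le_trans _ _ (move_rate beta u (o, a)))//; last first.
  by rewrite lerDl sumr_ge0// => i _; rewrite ltW// move_rate_gt0.
rewrite -expR0 ler_expR mulr_ge0// ler0z.
by apply: le_trans (ao a).
Qed.

Lemma total_rate_gt0 u : 0 < total_rate beta u.
Proof. exact: lt_le_trans (total_rate_ge1 u). Qed.

Lemma move_prob_ge0 u i : 0 <= move_prob beta u i.
Proof. by rewrite divr_ge0// ltW// ?move_rate_gt0 ?total_rate_gt0. Qed.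

Lemma sum_move_prob u : \sum_i move_prob beta u i = 1.
Proof. by rewrite -mulr_suml divff// gt_eqF// total_rate_gt0. Qed.

(** The number of possible moves. *)
Definition choices : R := (2 * N)%:R.

Lemma choices_gt0 : 0 < choices.
Proof. by rewrite ltr0n muln_gt0/= (leq_trans _ N_ge3). Qed.

Lemma total_rate_le u r : (forall i, move_rate beta u i <= r) ->
  total_rate beta u <= choices * r.
Proof.
move=> h; apply: (le_trans (ler_sum _ (fun i _ => h i))).
by rewrite sumr_const card_prod card_bool card_ord -mulr_natl.
Qed.

Lemma loud_prob u w : loud u w ->
  exists2 i, w = speak u i & choices^-1 <= move_prob beta u i.
Proof.
move=> [a [ o [-> h]]]; exists (o, a) => //.
rewrite /move_prob ler_pdivlMr ?total_rate_gt0// mulrC ler_pdivrMr ?choices_gt0// mulrC.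
apply: total_rate_le => i; apply: ler_move_rate.
by apply: le_trans (h i.2); rewrite /opinion_val; case: (i.1); lia.
Qed.

Lemma bounded_step_prob B u w : bounded_step B u w ->
  exists2 i, w = speak u i &
    (choices * expR (beta * (B + B)%:R))^-1 <= move_prob beta u i.
Proof.
move=> [[a [ o ->]] uB]; exists (o, a) => //.
have h i : - B%:R <= ((opinion_val i.1 * val u i.2)%:~R : R) <= B%:R.
  rewrite -[B%:R]/(B%:Z%:~R) -intrN !ler_int.
  by move: (uB i.2); rewrite /opinion_val; case: (i.1); lia.
have tl : total_rate beta u <= choices * expR (beta * B%:R).
  by apply: total_rate_le => i; rewrite ler_expR ler_wpM2l//; case/andP: (h i).
rewrite /move_prob ler_pdivlMr ?total_rate_gt0// mulrC ler_pdivrMr; last first.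
  by rewrite mulr_gt0 ?choices_gt0 ?expR_gt0.
apply: (le_trans tl); rewrite mulrCA ler_wpM2l ?(ltW choices_gt0)//.
rewrite -expRD ler_expR -mulrDr ler_wpM2l//=.
by have /andP[+ _] := h (o, a); rewrite natrD /=; lra.
Qed.

Definition target : set (state N) := @ladder N `|` @consensus_neg N.

Definition target_survival : R := 1 - choices^-1 ^+ @loud_steps N.

Local Notation kill := (kill (move_prob beta) speak).
Local Notation fading := (fading (move_prob beta) speak).

Let choicesV : 0 <= choices^-1 <= 1.
Proof.
rewrite invr_ge0 (ltW choices_gt0)/= invf_le1 ?choices_gt0// ler1n muln_gt0/=.
by rewrite (leq_trans _ N_ge3).
Qed.

(** Loud moves have probability at least [1 / (2 N)], so the bound is uniform in
    [beta]. *)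
Lemma target_fading : fading \1_(~` target) (@loud_steps N).+1 target_survival.
Proof.
split; first by rewrite gtrBl exprn_gt0// invr_gt0 choices_gt0.
move=> u; apply: (reach_fading move_prob_ge0 sum_move_prob choicesV loud_prob).
by apply: reach_target; apply: leq_trans N_ge3.
Qed.

(** In contrast with the previous bound, this one degenerates as [beta] grows: it
    only serves to make the equations for the hitting time of the negative
    consensus well posed. *)
Lemma neg_fading :
  exists n, exists rho, fading \1_(~` @consensus_neg N) n rho.
Proof.
have N1 : (1 < N)%N by apply: leq_trans N_ge3.
pose d : R := (choices * expR (beta * (N + N + (N + N))%:R))^-1.
have c1 : 1 <= choices.
  by rewrite ler1n muln_gt0/= (leq_trans _ N_ge3).
have e1 : 1 <= expR (beta * (N + N + (N + N))%:R).
  by rewrite -expR0 ler_expR mulr_ge0// ler0n.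
have d0 : 0 < d by rewrite invr_gt0 mulr_gt0 ?expR_gt0 ?choices_gt0.
have dc : d <= choices^-1.
  by rewrite lef_pV2 ?posrE ?mulr_gt0 ?expR_gt0 ?choices_gt0// ler_peMr// ltW ?choices_gt0.
have d1 : 0 <= d <= 1 by rewrite (ltW d0)/= (le_trans dc)//; case/andP: choicesV.
pose step u w := exists2 i, w = speak u i & d <= move_prob beta u i.
exists (@loud_steps N + N).+1, (1 - d ^+ (@loud_steps N + N)); split.
  by rewrite gtrBl exprn_gt0.
move=> u; apply: (@reach_fading _ _ _ _ _ move_prob_ge0 sum_move_prob step) => //.
apply: (@reach_trans _ _ target) => [w wt|].
  apply: sub_reach (reach_neg N1 wt) => {wt u}u {}w; exact: bounded_step_prob.
apply: sub_reach (reach_target u (ltnW N1)) => {u} u w /loud_prob[i ? ?].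
by exists i => //; exact: le_trans dc _.
Qed.

End rates.

End opinion_chain.

(** * Escaping from a positive consensus is slow *)

Section escape.
Context {R : realType} {N : nat}.
Hypothesis N_ge3 : (3 <= N)%N.
Implicit Types (beta delta : R) (u w : state N) (i : opinion * 'I_N).

Definition unique_zero : set (state N) :=
  [set u : state N | exists2 a, val u a = 0 & forall b, b != a -> 1 <= val u b].

Definition high_unique_zero : set (state N) :=
  [set u : state N | unique_zero u /\ exists b, 2 <= val u b].

(** An upper bound, up to a small drift, for the probability to leave the positive
    consensus. Moves of opinion [+1] lead to [high_unique_zero] in at most two steps;
    [delta] stands for the odds of a move of opinion [-1] before each of them. *)
Definition escape delta u : R :=
  if `[< high_unique_zero u >] then 0 else
  if `[< unique_zero u >] then delta else
  if `[< consensus_pos u >] then delta + delta else 1.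

Lemma exists_other a : exists b : 'I_N, b != a.
Proof.
have /card_gt0P[b ba] : (0 < #|predC1 a|)%N.
  by rewrite cardC1 card_ord -subn1 subn_gt0 (leq_trans _ N_ge3).
by exists b.
Qed.

Lemma exists_third a b : exists c : 'I_N, c != a /\ c != b.
Proof.
have /card_gt0P[c] : (0 < #|predC (pred2 a b)|)%N.
  rewrite -(ltn_add2l #|pred2 a b|) cardC addn0 card2 card_ord.
  by apply: leq_trans N_ge3; case: (a != b).
by rewrite !inE negb_or => /andP[ca cb]; exists c.
Qed.

Lemma consensus_pos_ge0 u : consensus_pos u -> forall a, 0 <= val u a.
Proof. by case. Qed.

Lemma unique_zero_consensus u : unique_zero u -> consensus_pos u.
Proof.
move=> [a ua u1]; split.
  have [b ba] := exists_other a.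
  by move=> /ffunP/(_ b); rewrite ffunE => ub; move: (u1 _ ba); rewrite ub.
by move=> b; have [->|/u1 h] := eqVneq b a; rewrite ?ua// (le_trans _ h).
Qed.

Lemma consensus_pos_high u : consensus_pos u -> exists a, 1 <= val u a.
Proof.
move=> [u0 uge]; apply: contrapT => h; apply: u0; apply/ffunP => a; rewrite ffunE.
apply/eqP; rewrite eq_le uge andbT leNgt; apply/negP => ua.
by apply: h; exists a; rewrite -gtz0_ge1.
Qed.

Lemma express_pos_unique_zero u a : consensus_pos u ->
  unique_zero (express_state a true u).
Proof.
move=> /consensus_pos_ge0 u0; exists a; first by rewrite val_express eqxx.
by move=> b ba; rewrite val_express (negbTE ba); move: (u0 b); rewrite /opinion_val; lia.
Qed.

Lemma express_pos_high u a : unique_zero u ->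
  high_unique_zero (express_state a true u).
Proof.
move=> uz; split; first exact: express_pos_unique_zero (unique_zero_consensus uz).
have [z _ u1] := uz; have [c [ca cz]] := exists_third a z.
by exists c; rewrite val_express (negbTE ca); move: (u1 _ cz); rewrite /opinion_val; lia.
Qed.

Lemma express_neg_zero u a : high_unique_zero u -> val u a = 0 ->
  consensus_pos (express_state a false u).
Proof.
move=> [[z uz u1] [b ub]] ua.
have az : a = z by apply/eqP/negP => /negP/u1; rewrite ua.
subst z; have ba : b != a by apply: contraTneq ub => ->; rewrite ua.
split.
  move=> /ffunP/(_ b); rewrite val_express (negbTE ba) ffunE.
  by move: ub; rewrite /opinion_val; lia.
move=> c; rewrite val_express; case: eqP => // /eqP/u1.
by rewrite /opinion_val; lia.
Qed.

Lemma ladder_high u : ladder u -> high_unique_zero u.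
Proof.
move=> [f f_inj fu].
have [g fK gK] := injF_bij f_inj.
have h k (kN : (k < N)%N) : val u (g (Ordinal kN)) = k%:Z by rewrite fu gK.
have N0 : (0 < N)%N by apply: leq_trans N_ge3.
split; last by exists (g (Ordinal N_ge3)); rewrite h.
exists (g (Ordinal N0)); first by rewrite h.
move=> b; rewrite fu -gtz0_ge1 ltz_nat lt0n; apply: contra => /eqP fb.
by rewrite -[b]fK; apply/eqP; congr g; exact/val_inj.
Qed.

Section escape_bounds.
Variable delta : R.
Hypotheses (d0 : 0 <= delta) (d1 : delta + delta <= 1).

Lemma escape_ge0 u : 0 <= escape delta u.
Proof. by rewrite /escape; case: ifP => // _; case: ifP => // _; case: ifP => // _; exact: addr_ge0. Qed.

Lemma escape_le1 u : escape delta u <= 1.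
Proof. by move: d0 d1; rewrite /escape; case: ifP => _; [|case: ifP => _; [|case: ifP => _]]; lra. Qed.

Lemma escape_high u : high_unique_zero u -> escape delta u = 0.
Proof. by move=> h; rewrite /escape asboolT. Qed.

Lemma escape_unique_zero u : unique_zero u -> escape delta u <= delta.
Proof. by move=> h; rewrite /escape (asboolT h); case: ifP. Qed.

Lemma escape_consensus u : consensus_pos u -> escape delta u <= delta + delta.
Proof.
by move: d0 => + h; rewrite /escape (asboolT h); case: ifP => _; [|case: ifP => _]; lra.
Qed.

Lemma escape_out u : ~ consensus_pos u -> escape delta u = 1.
Proof.
move=> h; rewrite /escape !asboolF// => [|[]] /unique_zero_consensus //.
Qed.
End escape_bounds.

(** From a high list with a unique zero, the actor at [0] expresses [-1] at rate [1]
    and leads to a positive consensus, where [escape] is at most [2 * delta]; the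
    other moves of opinion [-1] have rate at most [exp (- beta)]. From the other
    positive consensus lists, the moves of opinion [+1] lower [escape] by [delta] at
    rate at least [exp beta], which makes up for the moves of opinion [-1], of total
    rate at most [N]. *)
Lemma escape_drift beta delta u : 0 <= beta -> delta = N%:R * expR (- beta) ->
  delta + delta <= 1 -> consensus_pos u ->
  total_rate beta u * (avg (move_prob beta) speak (escape delta) u - escape delta u)
    <= 3 * delta.
Proof.
move=> b0 dE d1 uC.
have d0 : 0 <= delta by rewrite dE mulr_ge0// ?ler0n// expR_ge0.
have Q0 : 0 < total_rate beta u by exact: total_rate_gt0.
have -> : total_rate beta u * (avg (move_prob beta) speak (escape delta) u - escape delta u)
   = \sum_i move_rate beta u i * (escape delta (speak u i) - escape delta u).
  rewrite mulrBr /avg mulr_sumr {2}/total_rate mulr_suml -sumrB.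
  apply: eq_bigr => i _; rewrite /move_prob mulrBr mulrA; congr (_ * _ - _).
  by rewrite mulrC divfK// gt_eqF.
have e0 w : 0 <= escape delta w by exact: escape_ge0.
have e1 w : escape delta w <= 1 by exact: escape_le1.
have ug0 := proj2 uC.
have neg_rate a : move_rate beta u (false, a) = expR (- beta * (val u a)%:~R).
  by rewrite /move_rate /express_rate /= mulN1r intrN mulrN mulNr.
have neg_rate1 a : move_rate beta u (false, a) <= 1.
  rewrite neg_rate -[leRHS]expR0 ler_expR mulNr oppr_le0 mulr_ge0// ler0z.
  exact: ug0.
have sumN (F : 'I_N -> R) r : (forall a, F a <= r) -> \sum_a F a <= N%:R * r.
  move=> h; apply: (le_trans (ler_sum _ (fun a _ => h a))).
  by rewrite sumr_const card_ord mulr_natl.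
rewrite sum_moves.
have [uh|uh] := pselect (high_unique_zero u).
  rewrite (escape_high _ uh) big1 ?add0r; last first.
    move=> a _; rewrite subr0 escape_high ?mulr0//.
    exact: express_pos_high (proj1 uh).
  have [[z uz u1] _] := uh.
  rewrite (bigD1 z)//= subr0.
  have hz : move_rate beta u (false, z) * escape delta (speak u (false, z)) <= delta + delta.
    rewrite neg_rate uz mulr0 expR0 mul1r escape_consensus//.
    exact: express_neg_zero.
  have hr : \sum_(i < N | i != z)
      move_rate beta u (false, i) * (escape delta (speak u (false, i)) - 0) <= delta.
    rewrite [leRHS]dE; apply: (@le_trans _ _ (\sum_(i < N | i != z) expR (- beta))).
      apply: ler_sum => a /u1 ua; rewrite subr0 neg_rate -[leRHS]mulr1.
      apply: ler_pM; rewrite ?expR_ge0 ?e0 ?e1//.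
      by rewrite ler_expR mulNr lerN2 ler_peMr// ler1z.
    rewrite big_mkcond/=; apply: sumN => a.
    by case: ifP => // _; exact: expR_ge0.
  by lra.
have [b ub] := consensus_pos_high uC.
have pos : \sum_a move_rate beta u (true, a) * (escape delta (speak u (true, a)) - escape delta u) <= - N%:R.
  have drop a : escape delta (speak u (true, a)) - escape delta u <= - delta.
    rewrite {2}/escape (asboolF uh) (asboolT uC); case: ifPn => [/asboolP uz|_].
      by rewrite escape_high ?sub0r//; exact: express_pos_high.
    have : escape delta (speak u (true, a)) <= delta.
      by apply: escape_unique_zero => //; exact: express_pos_unique_zero.
    by lra.
  apply: (@le_trans _ _ (\sum_a move_rate beta u (true, a) * - delta)).
    by apply: ler_sum => a _; rewrite ler_wpM2l// ltW// move_rate_gt0.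
  rewrite -mulr_suml mulrN lerN2 dE.
  rewrite mulrCA ler_peMr ?ler0n// expRN ler_pdivlMr ?expR_gt0// mul1r.
  rewrite (bigD1 b)//=; apply: (@le_trans _ _ (move_rate beta u (true, b))).
    by rewrite ler_expR mul1r ler_peMr// ler1z.
  by rewrite lerDl sumr_ge0// => a _; rewrite ltW// move_rate_gt0.
have neg : \sum_a move_rate beta u (false, a) * (escape delta (speak u (false, a)) - escape delta u) <= N%:R.
  rewrite -[leRHS]mulr1; apply: sumN => a.
  apply: (@le_trans _ _ (move_rate beta u (false, a))) => //.
  rewrite ler_piMr ?(ltW (move_rate_gt0 _ _ _))//.
  have := e1 (speak u (false, a)); have := e0 u; lra.
by lra.
Qed.

End escape.

(** * Symmetry under renaming of the actors *)

Section relabeling.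
Context {R : realType} {N : nat}.
Implicit Types (beta : R) (u w : state N) (f c b : state N -> R).

Definition relabeled u w :=
  exists s : {perm 'I_N}, forall a, val w a = val u (s a).

Definition label_free f := forall u w, relabeled u w -> f u = f w.

Lemma relabeled_sym u w : relabeled u w -> relabeled w u.
Proof. by move=> [s h]; exists s^-1%g => a; rewrite h permKV. Qed.

Let reindex_moves (s : {perm 'I_N}) (F : opinion * 'I_N -> R) :
  \sum_i F i = \sum_i F (i.1, s i.2).
Proof.
rewrite (reindex (fun i : opinion * 'I_N => (i.1, s i.2)))//.
apply: onW_bij; exists (fun i => (i.1, (s^-1)%g i.2)) => -[ o a] /=.
  by rewrite permK.
by rewrite permKV.
Qed.

Let rate_relabel beta (s : {perm 'I_N}) u w : (forall a, val w a = val u (s a)) ->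
  forall i, move_rate beta u (i.1, s i.2) = move_rate beta w i.
Proof. by move=> h i; rewrite /move_rate /express_rate /= h. Qed.

Lemma total_rate_label_free beta : label_free (total_rate beta).
Proof.
move=> u w [s h]; rewrite /total_rate (reindex_moves s).
by apply: eq_bigr => i _; rewrite (rate_relabel _ h).
Qed.

Lemma avg_label_free beta f : label_free f -> label_free (avg (move_prob beta) speak f).
Proof.
move=> hf u w uw; have [s h] := uw; rewrite /avg (reindex_moves s).
apply: eq_bigr => i _; rewrite /move_prob (rate_relabel _ h) (total_rate_label_free beta uw).
congr (_ * _); apply: hf; exists s => a; rewrite !val_express /= (inj_eq perm_inj).
by case: eqP => // _; rewrite h.
Qed.

Lemma green_label_free beta c b : label_free c -> label_free b ->
  label_free (green (move_prob beta) speak c b).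
Proof.
move=> hc hb u w uw; rewrite /green.
suff it k : label_free (iter k (kill (move_prob beta) speak c) b).
  rewrite (_ : (fun k => _ u) = (fun k => iter k (kill (move_prob beta) speak c) b w))//.
  by apply/funext => k; exact: it.
elim: k => //= k IH {uw}u {}w uw.
by rewrite /kill (hc _ _ uw) (avg_label_free beta IH uw).
Qed.

Lemma indic_label_free (A : set (state N)) :
  (forall u w, relabeled u w -> A u -> A w) -> label_free \1_A.
Proof.
move=> hA u w uw; rewrite !indicE; congr (_%:R); congr nat_of_bool.
apply/idP/idP => /set_mem Ax; apply/mem_set; first exact: hA uw Ax.
exact: hA (relabeled_sym uw) Ax.
Qed.

Lemma consensus_neg_relabel u w : relabeled u w ->
  @consensus_neg N u -> @consensus_neg N w.
Proof.
move=> [s h] [u0 ule]; split=> [w0|a]; last by rewrite h.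
by apply: u0; apply/ffunP => a; rewrite -(permKV s a) -h w0 !ffunE.
Qed.

Lemma ladder_relabel u w : relabeled u w -> ladder u -> ladder w.
Proof.
move=> [s h] [f f_inj fu]; exists (f \o s) => [|a]; last by rewrite h fu.
by apply: inj_comp => //; exact: perm_inj.
Qed.

Lemma ladder_relabeled u w : ladder u -> ladder w -> relabeled u w.
Proof.
move=> [f f_inj fu] [g g_inj gw]; have [f' fK f'K] := injF_bij f_inj.
have inj : injective (f' \o g) by apply: inj_comp => //; exact: can_inj f'K.
by exists (perm inj) => a; rewrite permE /= gw fu f'K.
Qed.

End relabeling.

(** * Hitting the negative consensus *)

Section hitting.
Context {R : realType} {N : nat}.
Variable beta : R.
Hypotheses (N_ge3 : (3 <= N)%N) (beta_ge0 : 0 <= beta).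
Implicit Types (theta eps : R) (u w l : state N).

Local Notation C := (@consensus_neg N).
Local Notation q := (total_rate beta).
Local Notation A := (avg (move_prob beta) speak).
Local Notation green := (green (move_prob beta) (@speak N)).
Local Notation fading := (fading (move_prob beta) (@speak N)).
Let p_ge0 := move_prob_ge0 N_ge3 beta_ge0.
Let p_sum1 := sum_move_prob N_ge3 beta_ge0.

Definition discount theta u : R := \1_(~` C) u * (q u / (q u + theta)).

(** Expected hitting times: the reward [1 / q] is the mean holding time. *)
Definition neg_time : state N -> R := green \1_(~` C) (fun u => \1_(~` C) u / q u).
Definition target_time : state N -> R :=
  green \1_(~` target) (fun u => \1_(~` target) u / q u).
(** The Laplace transform at [theta] of the hitting time of [C], that is the
    probability to reach [C] before an exponential clock of rate [theta]. *)
Definition neg_laplace theta : state N -> R := green (discount theta) \1_C.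
(** Probability to hit [C] before [ladder]. *)
Definition neg_first : state N -> R := green \1_(~` target) \1_C.
(** Expected time spent before hitting [C] in the set of states from which [C]
    comes before [ladder] with probability at least [eps]. *)
Definition risky_time eps : state N -> R :=
  green \1_(~` C) (fun u => \1_[set u | eps <= neg_first u] u * \1_(~` C) u / q u).

Let q0 u : 0 < q u. Proof. exact: total_rate_gt0. Qed.
Let q1 u : 1 <= q u. Proof. exact: total_rate_ge1. Qed.

Let ind01 (B : set (state N)) u : 0 <= (\1_B u : R) <= 1.
Proof. by rewrite indicE; case: (_ \in _); rewrite ?lexx ?ler01. Qed.

Let ind_in (B : set (state N)) u : B u -> (\1_B u : R) = 1.
Proof. by move=> Bu; rewrite indicE mem_set. Qed.
Let ind_out (B : set (state N)) u : ~ B u -> (\1_B u : R) = 0.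
Proof. by move=> Bu; rewrite indicE memNset. Qed.

Let disc01 theta u : 0 <= theta -> 0 <= discount theta u <= \1_(~` C) u.
Proof.
move=> t0; have := q0 u; have /andP[i0 i1] := ind01 (~` C) u.
have qt : 0 <= q u / (q u + theta) <= 1.
  have qt0 : 0 < q u + theta by rewrite ltr_pwDl.
  by rewrite divr_ge0 ?(ltW qt0) ?(ltW (q0 u))//= ler_pdivrMr// mul1r lerDl.
by case/andP: qt => ? ? _; rewrite /discount mulr_ge0//= ler_piMr.
Qed.

Let disc01' theta u : 0 <= theta -> 0 <= discount theta u <= 1.
Proof.
by move=> /(disc01 u)/andP[-> h]; rewrite (le_trans h)//; case/andP: (ind01 (~` C) u).
Qed.

Let fadeC : exists n rho, fading \1_(~` C) n rho.
Proof. by have [n [rho h]] := neg_fading N_ge3 beta_ge0; exists n, rho. Qed.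

Let fadeT := target_fading N_ge3 beta_ge0.

Let fade_disc theta : 0 <= theta -> exists n rho, fading (discount theta) n rho.
Proof.
move=> t0; have [n [rho h]] := fadeC; exists n, rho.
by apply: fadingW h => // u; exact: disc01.
Qed.

Let fade_sub (D : set (state N)) : D `<=` ~` C -> exists n rho, fading \1_D n rho.
Proof.
move=> DC; have [n [rho h]] := fadeC; exists n, rho.
apply: fadingW h => // u; case/andP: (ind01 D u) => -> _ /=.
have [Du|Du] := pselect (D u); last by rewrite (ind_out Du); case/andP: (ind01 (~` C) u).
by rewrite (ind_in Du) ind_in//; exact: DC.
Qed.

Let maxP (D : set (state N)) (f : state N -> R) : D `<=` ~` C ->
  (exists M, forall u, f u <= M) ->
  (forall u, D u -> 0 < f u -> f u <= A f u) ->
  (forall u, ~ D u -> f u <= 0) -> forall u, f u <= 0.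
Proof.
move=> DC [M fM] fD fND; have [n [rho h]] := fade_sub DC.
exact: (maximum_principle p_ge0 p_sum1 h fM fD fND).
Qed.

Let rew01 (B : set (state N)) u : 0 <= \1_B u / q u <= 1.
Proof.
have /andP[i0 i1] := ind01 B u; rewrite divr_ge0 ?(ltW (q0 u))//=.
by rewrite ler_pdivrMr// mul1r (le_trans i1).
Qed.

Let rewB_ge0 (B : set (state N)) u : 0 <= \1_B u / q u.
Proof. by case/andP: (rew01 B u). Qed.

Let rew_risky eps u : \1_[set u | eps <= neg_first u] u * \1_(~` C) u / q u =
  \1_([set u | eps <= neg_first u] `&` ~` C) u / q u.
Proof. by rewrite indicI. Qed.

Lemma neg_time_neg u : C u -> neg_time u = 0.
Proof.
move=> Cu; have [n [rho h]] := fadeC.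
rewrite /neg_time (greenE p_ge0 p_sum1 (ind01 _) h (rewB_ge0 _) (beta := 1)).
  by rewrite /kill ind_out ?mul0r ?addr0.
by move=> w; case/andP: (rew01 (~` C) w).
Qed.

Lemma neg_timeE u : ~ C u -> neg_time u = (q u)^-1 + A neg_time u.
Proof.
move=> Cu; have [n [rho h]] := fadeC.
rewrite {1}/neg_time (greenE p_ge0 p_sum1 (ind01 _) h (rewB_ge0 _) (beta := 1)).
  by rewrite /kill ind_in// !mul1r.
by move=> w; case/andP: (rew01 (~` C) w).
Qed.

Lemma neg_time_ge0 u : 0 <= neg_time u.
Proof.
have [n [rho h]] := fadeC.
apply: (green_ge0 p_ge0 p_sum1 (ind01 _) h (rewB_ge0 _) (beta := 1)).
by move=> w; case/andP: (rew01 (~` C) w).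
Qed.

Lemma cvg_neg_time u :
  series (fun k => iter k (kill (move_prob beta) speak \1_(~` C))
    (fun w => \1_(~` C) w / q w) u) @ \oo --> neg_time u.
Proof.
have [n [rho h]] := fadeC.
apply: (cvg_green p_ge0 p_sum1 (ind01 _) h (rewB_ge0 _) (beta := 1)).
by move=> w; case/andP: (rew01 (~` C) w).
Qed.

Lemma neg_time_bounded : exists M, forall u, neg_time u <= M.
Proof.
have [n [rho h]] := fadeC; eexists => u.
apply: (green_le p_ge0 p_sum1 (ind01 _) h (rewB_ge0 _) (beta := 1)).
by move=> w; case/andP: (rew01 (~` C) w).
Qed.

Lemma target_time_target u : target u -> target_time u = 0.
Proof.
move=> Tu; rewrite /target_time (greenE p_ge0 p_sum1 (ind01 _) fadeT (rewB_ge0 _) (beta := 1)).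
  by rewrite /kill ind_out ?mul0r ?addr0.
by move=> w; case/andP: (rew01 (~` target) w).
Qed.

Lemma target_timeE u : ~ target u -> target_time u = (q u)^-1 + A target_time u.
Proof.
move=> Tu; rewrite {1}/target_time (greenE p_ge0 p_sum1 (ind01 _) fadeT (rewB_ge0 _) (beta := 1)).
  by rewrite /kill ind_in// !mul1r.
by move=> w; case/andP: (rew01 (~` target) w).
Qed.

Lemma target_time_ge0 u : 0 <= target_time u.
Proof.
apply: (green_ge0 p_ge0 p_sum1 (ind01 _) fadeT (rewB_ge0 _) (beta := 1)).
by move=> w; case/andP: (rew01 (~` target) w).
Qed.

Definition target_bound : R :=
  (@loud_steps N).+1%:R * 1 / (1 - @target_survival R N).

Lemma target_time_le u : target_time u <= target_bound.
Proof.
apply: (green_le p_ge0 p_sum1 (ind01 _) fadeT (rewB_ge0 _) (beta := 1)).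
by move=> w; case/andP: (rew01 (~` target) w).
Qed.

Let ind_ge0 (B : set (state N)) u : 0 <= (\1_B u : R).
Proof. by case/andP: (ind01 B u). Qed.
Let ind_le1 (B : set (state N)) u : (\1_B u : R) <= 1.
Proof. by case/andP: (ind01 B u). Qed.

Lemma ladder_not_neg u : ladder u -> ~ C u.
Proof.
move=> /(ladder_high N_ge3)[_ [b ub]] [_ /(_ b)].
by rewrite leNgt (lt_le_trans _ ub).
Qed.

Lemma neg_first_neg u : C u -> neg_first u = 1.
Proof.
move=> Cu; rewrite /neg_first (greenE p_ge0 p_sum1 (ind01 _) fadeT (ind_ge0 _) (beta := 1))//.
by rewrite /kill (ind_in Cu) ind_out ?mul0r ?addr0// => /(_ (or_intror Cu)).
Qed.

Lemma neg_first_ladder u : ladder u -> neg_first u = 0.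
Proof.
move=> lu; rewrite /neg_first (greenE p_ge0 p_sum1 (ind01 _) fadeT (ind_ge0 _) (beta := 1))//.
rewrite /kill (ind_out (ladder_not_neg lu)) ind_out ?mul0r ?addr0// => h.
by apply: h; left.
Qed.

Lemma neg_firstE u : ~ target u -> neg_first u = A neg_first u.
Proof.
move=> Tu; rewrite {1}/neg_first (greenE p_ge0 p_sum1 (ind01 _) fadeT (ind_ge0 _) (beta := 1))//.
rewrite /kill ind_out ?add0r ?ind_in ?mul1r//.
by move=> Cu; apply: Tu; right.
Qed.

Lemma neg_first_ge0 u : 0 <= neg_first u.
Proof.
by apply: (green_ge0 p_ge0 p_sum1 (ind01 _) fadeT (ind_ge0 _) (beta := 1)).
Qed.

Lemma neg_first_le1 u : neg_first u <= 1.
Proof.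
rewrite -subr_le0; move: u; apply: (@maxP (~` target)).
- by move=> u Tu Cu; apply: Tu; right.
- exists (target_bound) => u; rewrite lerBlDr; apply: le_trans (_ : target_bound <= _); last by rewrite lerDl.
  exact: (green_le p_ge0 p_sum1 (ind01 _) fadeT (ind_ge0 _) (beta := 1)).
- by move=> u Tu _; rewrite avgB avg_cst// -neg_firstE.
- move=> u /contrapT[]; first by move=> lu; rewrite neg_first_ladder// sub0r lerN10.
  by move=> Cu; rewrite (neg_first_neg Cu) subrr.
Qed.

Section laplace.
Variable theta : R.
Hypothesis theta_ge0 : 0 <= theta.

Let psi := neg_laplace theta.

Lemma neg_laplace_neg u : C u -> psi u = 1.
Proof.
move=> Cu; have [n [rho h]] := fade_disc theta_ge0.
rewrite /psi /neg_laplace (greenE p_ge0 p_sum1 (fun u => disc01' u theta_ge0) h (ind_ge0 _) (beta := 1))//.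
by rewrite /kill /discount (ind_in Cu) ind_out ?mul0r ?addr0.
Qed.

Lemma neg_laplace_ge0 u : 0 <= psi u.
Proof.
have [n [rho h]] := fade_disc theta_ge0.
exact: (green_ge0 p_ge0 p_sum1 (fun u => disc01' u theta_ge0) h (ind_ge0 _) (beta := 1)).
Qed.

Lemma cvg_neg_laplace_series u :
  series (fun k => iter k (kill (move_prob beta) speak (discount theta)) \1_C u)
    @ \oo --> psi u.
Proof.
have [n [rho h]] := fade_disc theta_ge0.
exact: (cvg_green p_ge0 p_sum1 (fun u => disc01' u theta_ge0) h (ind_ge0 _) (beta := 1)).
Qed.

Lemma neg_laplaceE u : ~ C u -> A psi u = psi u + theta * (q u)^-1 * psi u.
Proof.
move=> Cu; have [n [rho h]] := fade_disc theta_ge0.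
have E : psi u = q u / (q u + theta) * A psi u.
  rewrite {1}/psi /neg_laplace
    (greenE p_ge0 p_sum1 (fun u => disc01' u theta_ge0) h (ind_ge0 _) (beta := 1))//.
  by rewrite /kill /discount (ind_out Cu) add0r ind_in// mul1r.
rewrite E; have := q0 u; have := theta_ge0 => t0 uq.
by field; rewrite !gt_eqF// ltr_pwDl.
Qed.

Lemma neg_laplace_le1 u : psi u <= 1.
Proof.
rewrite -subr_le0; move: u; apply: (@maxP (~` C)) => //.
- have [n [rho h]] := fade_disc theta_ge0; exists (n%:R * 1 / (1 - rho)) => u.
  rewrite lerBlDr; apply: (@le_trans _ _ (n%:R * 1 / (1 - rho))); last by rewrite lerDl.
  exact: (green_le p_ge0 p_sum1 (fun u => disc01' u theta_ge0) h (ind_ge0 _) (beta := 1)).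
- move=> u Cu _; rewrite avgB avg_cst// neg_laplaceE// lerD2r lerDl.
  by rewrite mulr_ge0 ?neg_laplace_ge0// mulr_ge0// invr_ge0 ltW.
- by move=> u /contrapT Cu; rewrite (neg_laplace_neg Cu) subrr.
Qed.

End laplace.

Section risky.
Variable eps : R.
Let B := [set u | eps <= neg_first u].

Let Bge0 u : 0 <= \1_B u * \1_(~` C) u / q u.
Proof. by rewrite rew_risky; case/andP: (rew01 (B `&` ~` C) u). Qed.
Let Ble1 u : \1_B u * \1_(~` C) u / q u <= 1.
Proof. by rewrite rew_risky; case/andP: (rew01 (B `&` ~` C) u). Qed.

Lemma risky_time_neg u : C u -> risky_time eps u = 0.
Proof.
move=> Cu; have [n [rho h]] := fadeC.
rewrite /risky_time (greenE p_ge0 p_sum1 (ind01 _) h Bge0 Ble1).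
by rewrite /kill (@ind_out (~` C))// ?mulr0 ?mul0r ?addr0.
Qed.

Lemma risky_timeE u : ~ C u ->
  risky_time eps u = \1_B u / q u + A (risky_time eps) u.
Proof.
move=> Cu; have [n [rho h]] := fadeC.
rewrite {1}/risky_time (greenE p_ge0 p_sum1 (ind01 _) h Bge0 Ble1).
by rewrite /kill (@ind_in (~` C))// mulr1 mul1r.
Qed.

Lemma risky_time_ge0 u : 0 <= risky_time eps u.
Proof.
have [n [rho h]] := fadeC.
exact: (green_ge0 p_ge0 p_sum1 (ind01 _) h Bge0 Ble1).
Qed.

Lemma risky_time_bounded : exists M, forall u, risky_time eps u <= M.
Proof.
have [n [rho h]] := fadeC; eexists => u.
exact: (green_le p_ge0 p_sum1 (ind01 _) h Bge0 Ble1).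
Qed.
End risky.

Let TC : ~` target `<=` ~` C.
Proof. by move=> u Tu Cu; apply: Tu; right. Qed.

Let notT u : ~ (~` target) u -> ladder u \/ C u.
Proof. by move=> /contrapT. Qed.

Let C_label_free : label_free (\1_C : state N -> R).
Proof. by apply: indic_label_free => u w; exact: consensus_neg_relabel. Qed.

Let Cc_label_free : label_free (\1_(~` C) : state N -> R).
Proof.
apply: indic_label_free => u w uw nC Cw; apply: nC.
exact: consensus_neg_relabel (relabeled_sym uw) Cw.
Qed.

Let Tc_label_free : label_free (\1_(~` target) : state N -> R).
Proof.
apply: indic_label_free => u w uw nT Tw; apply: nT.
case: Tw => [/ladder_relabel|/consensus_neg_relabel] h; [left|right]; apply: h;
  exact: relabeled_sym.
Qed.

Let neg_time_label_free : label_free neg_time.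
Proof.
apply: green_label_free => // u w uw.
by rewrite (Cc_label_free uw) (total_rate_label_free beta uw).
Qed.

Let neg_laplace_label_free theta : label_free (neg_laplace theta).
Proof.
apply: green_label_free => // u w uw.
by rewrite /discount (Cc_label_free uw) (total_rate_label_free beta uw).
Qed.

Let neg_first_label_free : label_free neg_first.
Proof. exact: green_label_free. Qed.

Let risky_time_label_free eps : label_free (risky_time eps).
Proof.
apply: green_label_free => // u w uw.
rewrite (Cc_label_free uw) (total_rate_label_free beta uw).
rewrite (@indic_label_free _ _ [set u | eps <= neg_first u] _ u w)// => z z' zz'.
by rewrite /= (neg_first_label_free zz').
Qed.

Section from_ladder.
Variable l : state N.
Hypothesis lP : ladder l.

Let m := neg_time l.

Let on_ladder (f : state N -> R) u : label_free f -> ladder u -> f u = f l.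
Proof. by move=> fl lu; apply: fl; exact: ladder_relabeled. Qed.

(** Strong Markov property at the hitting time of the target. *)
Lemma neg_time_le u : neg_time u <= target_time u + m.
Proof.
rewrite -subr_le0; move: u; apply: (maxP TC).
- have [M hM] := neg_time_bounded; exists M => u; rewrite lerBlDr.
  by rewrite (le_trans (hM u))// lerDl addr_ge0 ?neg_time_ge0 ?target_time_ge0.
- move=> u Tu _; rewrite avgB avgD avg_cst// neg_timeE; last exact: TC.
  by rewrite target_timeE//; lra.
- move=> u /notT[lu|Cu].
    by rewrite (on_ladder neg_time_label_free lu) target_time_target ?add0r ?subrr//; left.
  by rewrite (neg_time_neg Cu) sub0r oppr_le0 addr_ge0 ?neg_time_ge0 ?target_time_ge0.
Qed.

(** If the ladder comes first, the whole time [m] is still to be waited. *)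
Lemma neg_time_ge u : m * (1 - neg_first u) <= neg_time u.
Proof.
rewrite -subr_le0; move: u; apply: (maxP TC).
- exists m => u; rewrite lerBlDr.
  apply: (@le_trans _ _ m); last by rewrite lerDl neg_time_ge0.
  by rewrite ler_piMr ?neg_time_ge0// gerBl neg_first_ge0.
- move=> u Tu _; rewrite avgB avgZ avgB avg_cst//.
  rewrite -(neg_firstE Tu) [in leLHS]neg_timeE; last exact: TC.
  have : 0 <= (q u)^-1 by rewrite invr_ge0 ltW.
  by lra.
- move=> u /notT[lu|Cu].
    by rewrite (on_ladder neg_time_label_free lu) neg_first_ladder// subr0 mulr1 subrr.
  by rewrite (neg_time_neg Cu) (neg_first_neg Cu) subrr mulr0 subrr.
Qed.

Section laplace_from_ladder.
Variable theta : R.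
Hypothesis theta_ge0 : 0 <= theta.
Let psi := neg_laplace theta.

(** The clock of rate [theta] rings before the target is reached with probability
    at most [theta * target_time u]. *)
Lemma neg_laplace_ge u : psi l * (1 - theta * target_time u) <= psi u.
Proof.
have p0 := neg_laplace_ge0 theta_ge0 l; rewrite -/psi in p0.
rewrite -subr_le0; move: u; apply: (maxP TC).
- exists (psi l) => u; rewrite lerBlDr.
  apply: (@le_trans _ _ (psi l)); last by rewrite lerDl neg_laplace_ge0.
  by rewrite ler_piMr// gerBl mulr_ge0// target_time_ge0.
- move=> u Tu; rewrite subr_gt0 => pos.
  rewrite avgB avgZ avgB avg_cst// avgZ neg_laplaceE//; last exact: TC.
  have : psi u <= psi l.
    apply: ltW; apply: (lt_le_trans pos); rewrite ler_piMr// gerBl.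
    by rewrite mulr_ge0// target_time_ge0.
  rewrite -subr_ge0 => h; have r0 : 0 <= theta / q u.
    by rewrite divr_ge0// ltW.
  have := mulr_ge0 r0 h; rewrite -/psi (target_timeE Tu); lra.
- move=> u /notT[lu|Cu].
    rewrite /psi (on_ladder (@neg_laplace_label_free theta) lu) target_time_target; last by left.
    by rewrite mulr0 subr0 mulr1 subrr.
  rewrite /psi (neg_laplace_neg theta_ge0 Cu) target_time_target; last by right.
  by rewrite mulr0 subr0 mulr1 subr_le0 neg_laplace_le1.
Qed.

Lemma neg_laplace_le u : psi u <= psi l + neg_first u.
Proof.
have p0 := neg_laplace_ge0 theta_ge0 l; rewrite -/psi in p0.
rewrite -subr_le0; move: u; apply: (maxP TC).
- exists 1 => u; rewrite lerBlDr.
  by rewrite (le_trans (neg_laplace_le1 theta_ge0 u))// lerDl addr_ge0// neg_first_ge0.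
- move=> u Tu _; rewrite avgB avgD avg_cst// neg_laplaceE//; last exact: TC.
  rewrite -neg_firstE// -/psi lerD2r lerDl mulr_ge0 ?neg_laplace_ge0//.
  by rewrite divr_ge0// ltW.
- move=> u /notT[lu|Cu].
    by rewrite /psi (on_ladder (@neg_laplace_label_free theta) lu) neg_first_ladder// addr0 subrr.
  rewrite /psi (neg_laplace_neg theta_ge0 Cu) (neg_first_neg Cu).
  by rewrite opprD addrCA subrr addr0 oppr_le0.
Qed.

(** The function [1 - psi] is the expected total of the reward [theta * psi / q]
    before [C], in which [psi] is at least nearly [psi l] by [neg_laplace_ge]. *)
Lemma laplace_defect_ge :
  theta * (1 - theta * target_bound) * psi l * m <= 1 - psi l.
Proof.
have p0 := neg_laplace_ge0 theta_ge0 l; rewrite -/psi in p0.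
set c := theta * _ * _.
suff h u : c * neg_time u - (1 - psi u) <= 0 by rewrite -subr_le0; exact: h.
move: u; apply: (@maxP (~` C)) => //.
- have [M hM] := neg_time_bounded; exists (`|c| * M) => u; rewrite lerBlDr.
  apply: (@le_trans _ _ (`|c| * M)); last first.
    by rewrite lerDl subr_ge0 neg_laplace_le1.
  apply: (@le_trans _ _ (`|c| * neg_time u)).
    by rewrite ler_wpM2r ?neg_time_ge0// ler_norm.
  by rewrite ler_wpM2l.
- move=> u Cu _; rewrite avgB avgZ avgB avg_cst// neg_laplaceE//.
  rewrite [in leLHS]neg_timeE//.
  have r0 : 0 <= theta / q u by rewrite divr_ge0// ltW.
  suff : 0 <= theta / q u * (psi u - (1 - theta * target_bound) * psi l).
    by rewrite /c /psi; lra.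
  apply: mulr_ge0 => //; rewrite subr_ge0; apply: le_trans (neg_laplace_ge u).
  rewrite mulrC ler_wpM2l// lerB// ler_wpM2l//; exact: target_time_le.
- by move=> u /contrapT Cu; rewrite (neg_time_neg Cu) /psi (neg_laplace_neg theta_ge0 Cu) mulr0 !subrr.
Qed.

(** The same representation of [1 - psi], in which [psi] is at most [psi l + eps]
    outside the risky states by [neg_laplace_le], and at most [1] inside. *)
Lemma laplace_defect_le eps : 0 <= eps ->
  1 - psi l <= theta * (psi l + eps) * m + theta * risky_time eps l.
Proof.
move=> e0; have p0 := neg_laplace_ge0 theta_ge0 l; rewrite -/psi in p0.
set c := theta * _.
have c0 : 0 <= c by rewrite mulr_ge0// addr_ge0.
suff h u : (1 - psi u) - (c * neg_time u + theta * risky_time eps u) <= 0.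
  by rewrite -subr_le0; exact: h.
move: u; apply: (@maxP (~` C)) => //.
- exists 1 => u; rewrite lerBlDr.
  apply: (@le_trans _ _ 1); first by rewrite gerBl neg_laplace_ge0.
  by rewrite lerDl addr_ge0// mulr_ge0 ?neg_time_ge0 ?risky_time_ge0.
- move=> u Cu _; rewrite !avgB avgD !avgZ avg_cst// neg_laplaceE//.
  rewrite [in leLHS]neg_timeE// [in leLHS](risky_timeE _ Cu).
  have r0 : 0 <= theta / q u by rewrite divr_ge0// ltW.
  set B := [set u | _].
  suff : 0 <= theta / q u * (psi l + eps + \1_B u - psi u).
    by rewrite /c /psi; lra.
  apply: mulr_ge0 => //; rewrite subr_ge0.
  have [Bu|Bu] := pselect (B u).
    rewrite (ind_in Bu); apply: (le_trans (neg_laplace_le1 theta_ge0 u)).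
    by rewrite lerDr addr_ge0.
  rewrite (ind_out Bu) addr0; apply: (le_trans (neg_laplace_le u)).
  by rewrite lerD2l; move/negP: Bu; rewrite -ltNge => /ltW.
- move=> u /contrapT Cu; rewrite (neg_time_neg Cu) risky_time_neg// /psi (neg_laplace_neg theta_ge0 Cu).
  by rewrite !mulr0 addr0 !subrr.
Qed.

End laplace_from_ladder.

Lemma risky_time_comparison eps u :
  risky_time eps u <= target_time u + risky_time eps l * (1 - neg_first u).
Proof.
rewrite -subr_le0; move: u; apply: (maxP TC).
- have [M hM] := risky_time_bounded eps; exists M => u; rewrite lerBlDr.
  rewrite (le_trans (hM u))// lerDl addr_ge0 ?target_time_ge0//.
  by rewrite mulr_ge0 ?risky_time_ge0// subr_ge0 neg_first_le1.
- move=> u Tu _; rewrite avgB avgD avgZ avgB avg_cst//.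
  rewrite -(neg_firstE Tu) [in leLHS](target_timeE Tu) [in leLHS](risky_timeE _ (TC Tu)).
  suff : \1_[set u | eps <= neg_first u] u / q u <= (q u)^-1 by lra.
  by rewrite ler_piMl// invr_ge0 ltW.
- move=> u /notT[lu|Cu].
    rewrite (on_ladder (@risky_time_label_free eps) lu) neg_first_ladder// target_time_target.
      by rewrite subr0 mulr1 add0r subrr.
    by left.
  rewrite risky_time_neg// (neg_first_neg Cu) target_time_target; last by right.
  by rewrite subrr mulr0 addr0 subrr.
Qed.

(** From a risky state, the target is reached in mean time at most [target_bound],
    and at [C] with probability at least [eps]. Hence the number of passages from the
    ladders to the risky states has mean at most [1 / eps]. *)
Lemma risky_time_le eps : 0 <= eps <= 1 -> eps * risky_time eps l <= target_bound.
Proof.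
move=> /andP[e0 e1]; set w := risky_time eps l.
have K0 : 0 <= target_bound by apply: le_trans (target_time_le l); exact: target_time_ge0.
have w0 : 0 <= w by exact: risky_time_ge0.
set s := target_bound + w * (1 - eps).
have s0 : 0 <= s by rewrite addr_ge0// mulr_ge0// subr_ge0.
suff h u : risky_time eps u - s <= 0 by have := h l; rewrite /s -/w; lra.
pose B := [set u | eps <= neg_first u].
move: u; apply: (@maxP (~` C `&` ~` B)).
- by move=> u [].
- have [M hM] := risky_time_bounded eps; exists M => u; rewrite lerBlDr.
  by rewrite (le_trans (hM u))// lerDl.
- move=> u [Cu Bu] _; rewrite avgB avg_cst// [in leLHS](risky_timeE _ Cu).
  by rewrite (@ind_out B)// mul0r add0r.
- move=> u; have [Cu _|Cu nD] := pselect (C u); first by rewrite risky_time_neg// sub0r oppr_le0.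
  have Bu : B u by apply: contrapT => Bu; exact: nD.
  rewrite subr_le0; apply: (le_trans (risky_time_comparison eps u)).
  by rewrite lerD ?target_time_le// ler_wpM2l// lerD2l lerN2.
Qed.

End from_ladder.

Section escape.
Variable delta : R.
Hypothesis (deltaE : delta = N%:R * expR (- beta)) (delta_small : delta + delta <= 1).

Let delta0 : 0 <= delta. Proof. by rewrite deltaE mulr_ge0// ?ler0n// expR_ge0. Qed.

Let phi : state N -> R := escape delta.

Let pos_not_neg u : consensus_pos u -> ~ C u.
Proof.
move=> [u0 uge] [_ ule]; apply: u0; apply/ffunP => a; rewrite ffunE.
by apply/eqP; rewrite eq_le uge ule.
Qed.

Let drift u : consensus_pos u -> A phi u <= phi u + 3 * delta / q u.
Proof.
move=> uC; have := escape_drift N_ge3 beta_ge0 deltaE delta_small uC.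
by rewrite -/phi -ler_pdivlMl// lerBlDl mulrC.
Qed.

(** The function [1 - escape] is [1] on the ladders, vanishes outside the positive
    consensus and, by [escape_drift], decreases at rate at most [3 * delta]. *)
Lemma neg_time_lower l : ladder l -> 1 <= 3 * delta * neg_time l.
Proof.
move=> lP; suff : (1 - phi l) - 3 * delta * neg_time l <= 0.
  by rewrite /phi escape_high ?subr0 ?subr_le0//; exact: ladder_high.
move: l {lP}; apply: (@maxP (@consensus_pos N)).
- by move=> u; exact: pos_not_neg.
- exists 1 => u; rewrite lerBlDr; apply: (@le_trans _ _ 1).
    by rewrite gerBl escape_ge0.
  by rewrite lerDl mulr_ge0 ?neg_time_ge0// mulr_ge0.
- move=> u uC _; rewrite avgB avgZ avgB avg_cst//.
  rewrite [in leLHS]neg_timeE; last exact: pos_not_neg.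
  by have := drift uC; lra.
- move=> u uC; rewrite /phi escape_out// subrr sub0r oppr_le0.
  by rewrite mulr_ge0 ?neg_time_ge0// mulr_ge0.
Qed.

(** During the time needed to reach the target, the drift of [escape] adds at most
    [3 * delta * target_time u]. *)
Lemma neg_first_small u : consensus_pos u ->
  neg_first u <= delta + delta + 3 * delta * target_bound.
Proof.
move=> uC; apply: (@le_trans _ _ (phi u + 3 * delta * target_time u)); last first.
  by rewrite lerD ?escape_consensus// ler_wpM2l ?mulr_ge0// target_time_le.
rewrite -subr_le0; move: u {uC}; apply: (@maxP (@consensus_pos N `&` ~` @ladder N)).
- by move=> u [/pos_not_neg].
- exists 1 => u; rewrite lerBlDr (le_trans (neg_first_le1 u))// lerDl.
  by rewrite addr_ge0 ?escape_ge0// mulr_ge0 ?target_time_ge0// mulr_ge0.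
- move=> u [uC ul] _.
  have Tu : ~ target u by case=> // /(pos_not_neg uC).
  rewrite avgB avgD avgZ -neg_firstE// [in leLHS](target_timeE Tu).
  by have := drift uC; lra.
- move=> u nD; have [lu|lu] := pselect (ladder u).
    rewrite neg_first_ladder// sub0r oppr_le0.
    by rewrite addr_ge0 ?escape_ge0// mulr_ge0 ?target_time_ge0// mulr_ge0.
  have uC : ~ consensus_pos u by move=> uC; exact: nD.
  rewrite /phi (escape_out N_ge3 _ uC) subr_le0.
  rewrite (le_trans (neg_first_le1 u))// lerDl.
  by rewrite mulr_ge0 ?target_time_ge0// mulr_ge0.
Qed.

End escape.

End hitting.

(** * Limit of the Laplace transforms *)

Section asymptotics.
Context {R : realType}.

(** The real arithmetic behind the limit. Here [m] and [h] are the mean hitting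
    times from a ladder and from the initial list, [ps] and [pv] the Laplace
    transforms at [lam / h] from the same points, [w] the mean risky time, [K] the
    bound on the time to reach the target, [1 / eta] a lower bound for [m]. The
    three groups of the error come from replacing [lam / h * m] by [lam], from the
    defect [1 - ps], and from replacing [pv] by [ps]. *)
Lemma laplace_estimate (lam K eta gam eps m h w ps pv : R) :
  0 < lam -> 0 <= K -> 0 <= gam <= 2^-1 -> 0 < eps -> 0 < eta ->
  1 <= eta * m -> m * (1 - gam) <= h -> h <= K + m ->
  0 <= ps <= 1 -> eps * w <= K ->
  lam / h * (1 - lam / h * K) * ps * m <= 1 - ps ->
  1 - ps <= lam / h * (ps + eps) * m + lam / h * w ->
  ps * (1 - lam / h * K) <= pv -> pv <= ps + gam ->
  `|pv - (1 + lam)^-1| <= 2 * lam * (K * eta + gam) +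
    (4 * lam ^+ 2 * eta * K + 2 * lam * eps + 2 * lam * eta * K / eps) +
    (2 * lam * eta * K + gam).
Proof.
move=> lam0 K0 /andP[g0 g2] eps0 eta0 etam hm hK /andP[ps0 ps1] wK lo up pvlo pvup.
have m0 : 0 < m by rewrite -(pmulr_rgt0 _ eta0) (lt_le_trans _ etam).
have h0 : 0 < h by apply: lt_le_trans hm; rewrite mulr_gt0// subr_gt0; lra.
have mh : m <= 2 * h.
  have : m * 2^-1 <= m * (1 - gam) by rewrite ler_wpM2l ?(ltW m0)//; lra.
  lra.
set th := lam / h in lo up pvlo *.
have th0 : 0 < th by rewrite divr_gt0.
have thh : th * h = lam by rewrite divfK// gt_eqF.
clearbody th.
have thm : th * m <= 2 * lam.
  by rewrite -thh mulrCA ler_wpM2l// ltW.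
have theta : th <= 2 * lam * eta.
  rewrite -[leLHS]mulr1; apply: (@le_trans _ _ (th * (eta * m))).
    by rewrite ler_wpM2l// ltW.
  by rewrite mulrCA mulrC ler_wpM2r// ltW.
have thK : th * K <= 2 * lam * eta * K by rewrite ler_wpM2r.
have F4 : `|th * m - lam| <= 2 * lam * (K * eta + gam).
  rewrite -{1}thh -mulrBr normrM (gtr0_norm th0).
  have mg : 0 <= m * gam by rewrite mulr_ge0// ltW.
  apply: (@le_trans _ _ (th * (K + m * gam))).
    by rewrite ler_wpM2l ?(ltW th0)// ler_norml; apply/andP; split; lra.
  rewrite mulrDr [leRHS]mulrDr; apply: lerD.
    by apply: (le_trans thK); rewrite le_eqVlt; apply/orP; left; apply/eqP; ring.
  by rewrite mulrA ler_wpM2r.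
have F5 : `|(1 + th * m) * ps - 1| <= 4 * lam ^+ 2 * eta * K + 2 * lam * eps + 2 * lam * eta * K / eps.
  have a1 : th * K * (th * m) * ps <= 4 * lam ^+ 2 * eta * K.
    apply: (@le_trans _ _ (th * K * (th * m))).
      by rewrite ler_piMr// !mulr_ge0// ltW.
    apply: (@le_trans _ _ (2 * lam * eta * K * (2 * lam))).
      by apply: ler_pM; rewrite ?mulr_ge0// ltW.
    by rewrite le_eqVlt; apply/orP; left; apply/eqP; ring.
  have a2 : th * m * eps <= 2 * lam * eps by rewrite ler_wpM2r// ltW.
  have a3 : th * w <= 2 * lam * eta * K / eps.
    apply: (@le_trans _ _ (th * K / eps)); last by rewrite ler_wpM2r// invr_ge0 ltW.
    by rewrite -mulrA ler_wpM2l ?(ltW th0)// ler_pdivlMr// mulrC.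
  have p1 : 0 <= 4 * lam ^+ 2 * eta * K.
    by rewrite !mulr_ge0// ?exprn_ge0// ltW.
  have p2 : 0 <= 2 * lam * eps by rewrite !mulr_ge0// ltW.
  have p3 : 0 <= 2 * lam * eta * K / eps.
    by rewrite divr_ge0 ?mulr_ge0// ltW.
  by rewrite ler_norml; apply/andP; split; lra.
have F7 : `|ps - (1 + lam)^-1| <= 2 * lam * (K * eta + gam) +
    (4 * lam ^+ 2 * eta * K + 2 * lam * eps + 2 * lam * eta * K / eps).
  have l1 : 0 < 1 + lam by lra.
  have -> : ps - (1 + lam)^-1 = (((1 + th * m) * ps - 1) + (lam - th * m) * ps) / (1 + lam).
    by field; rewrite gt_eqF.
  rewrite normrM normfV (gtr0_norm l1) ler_pdivrMr//.
  apply: (@le_trans _ _ (2 * lam * (K * eta + gam) +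
    (4 * lam ^+ 2 * eta * K + 2 * lam * eps + 2 * lam * eta * K / eps))); last first.
    have A0 := le_trans (normr_ge0 _) F4; have B0 := le_trans (normr_ge0 _) F5.
    by rewrite ler_peMr ?(addr_ge0 A0 B0)// lerDl ltW.
  apply: (le_trans (ler_normD _ _)); rewrite addrC lerD//.
  apply: le_trans F4; rewrite normrM distrC ler_piMr// ger0_norm//.
rewrite -[pv](subrK ps) -addrA addrC; apply: (le_trans (ler_normD _ _)); apply: lerD => //.
have thKp : 0 <= th * K by rewrite mulr_ge0// ltW.
have : th * K * ps <= th * K by rewrite ler_piMr.
by move=> ?; rewrite ler_norml; apply/andP; split; lra.
Qed.

Section opinion.
Context {N : nat}.
Hypothesis N_ge3 : (3 <= N)%N.
Variable v : state N.
Hypothesis vC : consensus_pos v.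

Lemma exists_ladder : exists l : state N, ladder l.
Proof.
have N0 : (0 < N)%N by apply: leq_trans N_ge3.
pose r : opinion_list N := [ffun a : 'I_N => (a : nat)%:Z].
have h : has_min_abs0 r.
  by apply/(has_min_abs0P _ N0); exists (Ordinal N0); rewrite ffunE.
by exists (exist _ r h), id => // a; rewrite ffunE.
Qed.

Lemma neg_time_gt0 (beta : R) : 0 <= beta -> 0 < neg_time beta v.
Proof.
move=> b0; have vnC : ~ consensus_neg v.
  by move=> vn; case: vC => v0 vge; apply: v0; apply/ffunP => a; rewrite ffunE;
    apply/eqP; rewrite eq_le vge (proj2 vn).
rewrite (neg_timeE N_ge3 b0 vnC) ltr_pwDl ?invr_gt0 ?total_rate_gt0//.
apply: avg_ge; [exact: move_prob_ge0|exact: sum_move_prob|].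
by move=> u; exact: neg_time_ge0.
Qed.

Lemma cvg_neg_laplace (lam : R) : 0 < lam ->
  neg_laplace beta (lam / neg_time beta v) v @[beta --> +oo] --> (1 + lam)^-1.
Proof.
move=> lam0; have [l lP] := exists_ladder.
pose K : R := @target_bound R N.
(* The level eps of the risky states has to vanish more slowly than 1 / m, which
   is at most of order exp (- beta). *)
pose s (beta : R) : R := expR (- (beta / 2)).
have s_cvg : s beta @[beta --> +oo] --> (0 : R).
  apply: (@cvg_comp _ _ _ (fun b : R => b / 2) (fun b => expR (- b)) _ (pinfty_nbhs R)).
    exact: gt0_cvgMly.
  exact: cvgr_expR.
pose cst : R := 2 * lam * (K * (3 * N%:R) + (2 + 3 * K) * N%:R) +
    (4 * lam ^+ 2 * (3 * N%:R) * K + 2 * lam + 2 * lam * (3 * N%:R) * K) +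
    (2 * lam * (3 * N%:R) * K + (2 + 3 * K) * N%:R).
have K0 : 0 <= K.
  by apply: le_trans (target_time_le N_ge3 (lexx 0) l); exact: target_time_ge0.
have nN : 0 <= N%:R :> R by [].
have l0 := ltW lam0.
have ll0 : 0 <= lam ^+ 2 by exact: exprn_ge0.
have cc0 : 0 <= 2 * (2 + 3 * K) * N%:R by apply: mulr_ge0 => //; lra.
have cst0 : 0 <= cst.
  rewrite /cst; do ?[exact: K0 | by [] | apply: addr_ge0 | apply: mulr_ge0].
have small : \forall beta \near +oo, s beta < (2 * (2 + 3 * K) * N%:R + 1)^-1.
  apply: (cvgr_lt 0 s_cvg); by rewrite invr_gt0 ltr_wpDl.
apply/cvgrPdist_le => e e0.
have small2 : \forall beta \near +oo, s beta < e / (cst + 1).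
  apply: (cvgr_lt 0 s_cvg); by rewrite divr_gt0// ltr_wpDl.
near=> beta.
have b0 : 0 <= beta by near: beta; exact: nbhs_pinfty_ge.
have s0 : 0 < s beta by exact: expR_gt0.
pose delta := N%:R * expR (- beta).
have n1 : 1 <= N%:R :> R by rewrite ler1n (leq_trans _ N_ge3).
have ss : expR (- beta) = s beta * s beta.
  by rewrite -expRD; congr expR; lra.
have sb : s beta * (2 * (2 + 3 * K) * N%:R + 1) < 1.
  rewrite -ltr_pdivlMr ?div1r; first by near: beta.
  by rewrite ltr_wpDl.
have s1 : s beta <= 1.
  rewrite /s -[leRHS]expR0 ler_expR; lra.
have s_ge0 := ltW s0.
have sN0 : 0 <= s beta * N%:R by exact: mulr_ge0.
have sNK : 0 <= s beta * (K * N%:R) by apply: mulr_ge0 => //; exact: mulr_ge0.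
have dsN : delta <= s beta * N%:R.
  by rewrite /delta ss mulrC ler_wpM2r// ler_piMr// ltW.
have d0 : 0 < delta by rewrite /delta mulr_gt0 ?expR_gt0// (lt_le_trans _ n1).
have dKN : delta * K <= s beta * (K * N%:R).
  apply: (@le_trans _ _ (s beta * N%:R * K)); first exact: ler_wpM2r.
  by rewrite le_eqVlt; apply/orP; left; apply/eqP; ring.
have d2 : delta + delta <= 1 by lra.
pose gam := delta + delta + 3 * delta * K.
have g2 : 0 <= gam <= 2^-1.
  have : 0 <= delta * K by rewrite mulr_ge0// ltW.
  by rewrite /gam; move=> ?; apply/andP; split; lra.
pose h := neg_time beta v; pose m := neg_time beta l.
have h0 : 0 < h by exact: neg_time_gt0.
have th0 : 0 <= lam / h by rewrite divr_ge0// ltW.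
have m0 : 0 <= m by exact: neg_time_ge0.
have gv := neg_first_small N_ge3 b0 (erefl delta) d2 vC.
have tv := target_time_le N_ge3 b0 v.
have p0 := neg_laplace_ge0 N_ge3 b0 th0 l.
have p1 := neg_laplace_le1 N_ge3 b0 th0 l.
have sb01 : 0 <= s beta <= 1 by rewrite (ltW s0).
have := @laplace_estimate lam K (3 * delta) gam (s beta) m h (risky_time beta (s beta) l)
  (neg_laplace beta (lam / h) l) (neg_laplace beta (lam / h) v) lam0 K0 g2 s0.
have q1 : m * (1 - gam) <= h.
  by apply: le_trans (neg_time_ge N_ge3 b0 lP v); rewrite ler_wpM2l// lerD2l lerN2.
have q2 : h <= K + m.
  by apply: (le_trans (neg_time_le N_ge3 b0 lP v)); rewrite lerD2r.
have q3 : neg_laplace beta (lam / h) l * (1 - lam / h * K) <= neg_laplace beta (lam / h) v.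
  apply: le_trans (neg_laplace_ge N_ge3 b0 lP th0 v).
  by rewrite ler_wpM2l// lerD2l lerN2 ler_wpM2l.
have q4 : neg_laplace beta (lam / h) v <= neg_laplace beta (lam / h) l + gam.
  by apply: (le_trans (neg_laplace_le N_ge3 b0 lP th0 v)); rewrite lerD2l.
move=> /(_ (mulr_gt0 (ltr0n _ 3) d0) (neg_time_lower N_ge3 b0 (erefl delta) d2 lP) q1 q2).
rewrite p0 p1 => /(_ isT (risky_time_le N_ge3 b0 lP sb01)).
move=> /(_ (laplace_defect_ge N_ge3 b0 lP th0)).
move=> /(_ (laplace_defect_le N_ge3 b0 lP th0 (ltW s0)) q3 q4).
rewrite distrC -/h => /le_trans; apply.
have se : s beta * (cst + 1) < e.
  rewrite -ltr_pdivlMr; first by near: beta.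
  by rewrite ltr_wpDl.
have dds : delta / s beta = s beta * N%:R.
  by rewrite /delta ss; field; rewrite gt_eqF.
have gs : gam <= s beta * ((2 + 3 * K) * N%:R) by rewrite /gam; lra.
have t1 := ler_wpM2l (ltW lam0) gs.
have t2 := ler_wpM2l (ltW lam0) dKN.
have t3 := ler_wpM2l ll0 dKN.
have -> : 2 * lam * (3 * delta) * K / s beta = 6 * lam * K * (s beta * N%:R).
  by rewrite -dds; ring.
apply: le_trans (ltW se); rewrite /cst; lra.
Unshelve. all: by end_near. Qed.

End opinion.

End asymptotics.

(** * Moments and distribution functions on the unit interval *)

Section polynomials.
Context {R : realType}.
Implicit Types (p : {poly R}) (x y e : R).

Lemma bernoulli_ge n y : 0 <= y -> 1 + n%:R * y <= (1 + y) ^+ n.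
Proof.
move=> y0; elim: n => [|n IH]; first by rewrite mul0r addr0 expr0.
rewrite exprS -natr1; apply: (@le_trans _ _ ((1 + y) * (1 + n%:R * y))).
  have : 0 <= n%:R * y * y by rewrite !mulr_ge0.
  lra.
by rewrite ler_wpM2l// addr_ge0.
Qed.

Lemma bernoulli_le n y : 0 <= y <= 1 -> 1 - n%:R * y <= (1 - y) ^+ n.
Proof.
move=> /andP[y0 y1]; elim: n => [|n IH]; first by rewrite mul0r subr0 expr0.
rewrite exprS -natr1; apply: (@le_trans _ _ ((1 - y) * (1 - n%:R * y))).
  have : 0 <= n%:R * y * y by rewrite !mulr_ge0.
  lra.
by rewrite ler_wpM2l// subr_ge0.
Qed.

(** The polynomial [(1 - X^k)^n] drops from [1] to [0] around the point where
    [n * x ^ k = 1], and the drop gets steeper as [k] grows. It suffices to choose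
    [n] between [1 / (e * x1 ^ k)] and [e / x0 ^ k]. *)
Lemma step_polynomial x0 x1 e : 0 <= x0 -> x0 < x1 -> x1 <= 1 -> 0 < e ->
  exists p, forall x, 0 <= x <= 1 ->
    [/\ 0 <= p.[x] <= 1, x <= x0 -> 1 - e <= p.[x] & x1 <= x -> p.[x] <= e].
Proof.
move=> x00 x01 x11 e0.
have x1_gt0 : 0 < x1 by exact: le_lt_trans x01.
have cr : (x0 / x1) ^+ k @[k --> \oo] --> (0 : R).
  by apply: cvg_expr; rewrite ger0_norm ?divr_ge0 ?(ltW x1_gt0)// ltr_pdivrMr// mul1r.
have cx : x0 ^+ k @[k --> \oo] --> (0 : R).
  by apply: cvg_expr; rewrite ger0_norm// (lt_le_trans x01).
have [k [k1 k2]] : exists k, (x0 / x1) ^+ k < e * e / 2 /\ x0 ^+ k < e / 2.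
  have n1 : \forall k \near \oo, (x0 / x1) ^+ k < e * e / 2.
    by apply: (cvgr_lt 0 cr); rewrite divr_gt0// mulr_gt0.
  have n2 : \forall k \near \oo, x0 ^+ k < e / 2.
    by apply: (cvgr_lt 0 cx); rewrite divr_gt0.
  by near \oo => k; exists k; split; near: k.
have xk0 : 0 < x1 ^+ k by exact: exprn_gt0.
pose t := (e * x1 ^+ k)^-1.
have t0 : 0 < t by rewrite invr_gt0 mulr_gt0.
pose n := (Num.truncn t).+1.
have tn : t <= n%:R by apply: ltW; rewrite /n truncnS_gt.
have nt : n%:R <= t + 1.
  by rewrite /n -natr1 lerD2r truncn_le// ltW.
exists ((1 - 'X^k) ^+ n) => x /andP[xge xle].
have h : ((1 - 'X^k) ^+ n).[x] = (1 - x ^+ k) ^+ n by rewrite !hornerE.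
have y0 : 0 <= x ^+ k by exact: exprn_ge0.
have y1 : x ^+ k <= 1 by exact: exprn_ile1.
have z0 : 0 <= 1 - x ^+ k by rewrite subr_ge0.
have z1 : 1 - x ^+ k <= 1 by rewrite gerBl.
rewrite h; split.
- by rewrite exprn_ge0//= exprn_ile1.
- move=> xx0; apply: le_trans (bernoulli_le n _); last by rewrite y0.
  rewrite lerD2l lerN2.
  have : x ^+ k <= x0 ^+ k by rewrite lerXn2r.
  move=> xk; apply: (@le_trans _ _ ((t + 1) * x0 ^+ k)).
    by apply: ler_pM.
  have : t * x0 ^+ k <= e / 2.
    rewrite /t invfM -mulrA mulrC ler_pdivrMr// [_^-1 * _]mulrC -expr_div_n.
    by rewrite (le_trans (ltW k1))//; lra.
  lra.
- move=> x1x; have x1k : x1 ^+ k <= x ^+ k by rewrite lerXn2r// nnegrE ltW.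
  have ny : e^-1 <= n%:R * x ^+ k.
    apply: (@le_trans _ _ (t * x1 ^+ k)).
      by rewrite /t invfM mulfVK// gt_eqF.
    by apply: ler_pM => //; exact: ltW.
  have b := bernoulli_ge n y0.
  have pr : (1 - x ^+ k) ^+ n * (1 + x ^+ k) ^+ n <= 1.
    rewrite -exprMn exprn_ile1//.
      by rewrite mulr_ge0// addr_ge0.
    by rewrite -subr_sqr expr1n gerBl exprn_ge0.
  have w0 : 0 <= (1 - x ^+ k) ^+ n by exact: exprn_ge0.
  have : (1 - x ^+ k) ^+ n * e^-1 <= 1.
    apply: le_trans pr; rewrite ler_wpM2l//; lra.
  by rewrite ler_pdivrMr// mul1r.
Unshelve. all: by end_near. Qed.

(** The integral of [p] over the unit interval, in terms of the moments
    [1 / (i + 1)] of the uniform law. *)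
Definition unit_mean p : R := \sum_(i < size p) p`_i / i.+1%:R.

Definition primitive p : {poly R} := \poly_(i < (size p).+1) (p`_i.-1 / i%:R).

Lemma deriv_primitive p : (primitive p)^`() = p.
Proof.
apply/polyP => i; rewrite coef_deriv coef_poly ltnS /=.
case: ltnP => [_|pi]; last by rewrite mul0rn nth_default.
by rewrite -[LHS]mulr_natr divfK// pnatr_eq0.
Qed.

Lemma primitive0 p : (primitive p).[0] = 0.
Proof. by rewrite horner_coef0 coef_poly /= invr0 mulr0. Qed.

Lemma primitive1 p : (primitive p).[1] = unit_mean p.
Proof.
rewrite horner_poly big_ord_recl/= invr0 mulr0 mul0r add0r.
by apply: eq_bigr => i _; rewrite expr1n mulr1.
Qed.

Lemma primitive_increment p x y m M : x <= y ->
  (forall z, x <= z <= y -> m <= p.[z] <= M) ->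
  m * (y - x) <= (primitive p).[y] - (primitive p).[x] <= M * (y - x).
Proof.
rewrite le_eqVlt => /predU1P[->|xy] h; first by rewrite !subrr !mulr0 lexx.
have [c cxy ->] := poly_mvt (primitive p) xy.
rewrite deriv_primitive !ler_pM2r ?subr_gt0// h//.
by move: cxy; rewrite in_itv/= => /andP[/ltW-> /ltW->].
Qed.

End polynomials.

Section moments.
Context {R : realType}.
Implicit Types (p : {poly R}) (c e : R).

Section integral.
Context d (T : measurableType d) (P : probability T R) (a : T -> R).
Hypotheses (ma : measurable_fun setT a) (a01 : forall x, 0 <= a x <= 1).

Lemma integrable_power k : P.-integrable setT (fun x => (a x ^+ k)%:E).
Proof.
apply: (@measurable_bounded_integrable _ _ _ _ (fun x => a x ^+ k)) => //.
- by apply: (le_lt_trans (probability_le1 P measurableT)); rewrite ltry.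
- exact: measurable_funX.
- exists 1; split=> // M M1 x _ /=; have /andP[a0 a1] := a01 x.
  by rewrite ger0_norm ?exprn_ge0// (le_trans (exprn_ile1 _ _ _))// ltW.
Qed.

Lemma integral_polynomial (mu : nat -> R) p :
  (forall k, \int[P]_x (a x ^+ k)%:E = (mu k)%:E)%E ->
  (\int[P]_x (p.[a x])%:E = (\sum_(i < size p) p`_i * mu i)%:E)%E.
Proof.
move=> hmu; under eq_integral do rewrite horner_coef -sumEFin.
rewrite integral_sum//; last first.
  move=> i; under eq_fun do rewrite EFinM.
  by apply: integrableZl => //; exact: integrable_power.
rewrite -sumEFin; apply: eq_bigr => i _; rewrite EFinM -hmu.
under eq_integral do rewrite EFinM.
by rewrite integralZl//; exact: integrable_power.
Qed.

Lemma measurable_lt_cst c : measurable [set x | a x < c].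
Proof.
have := ma measurableT (measurable_itv `]-oo, c[); rewrite setTI.
by congr measurable; apply/seteqP; split=> x /=; rewrite in_itv.
Qed.

Lemma measurable_polynomial p : measurable_fun setT (fun x => (p.[a x])%:E).
Proof.
apply/measurable_EFinP; rewrite (_ : (fun x => _) = (fun x => \sum_(i < size p) p`_i * a x ^+ i)).
  apply: measurable_sum => i; apply: measurable_funM => //; exact: measurable_funX.
by apply/funext => x; rewrite horner_coef.
Qed.

End integral.

(** The indicator of [a < c] is bounded above and below, up to [e / 4], by
    polynomials that drop just after and just before [c]. Finitely many moments
    determine the means of these two polynomials. *)
Lemma cdf_of_moments c e : 0 < c <= 1 -> 0 < e ->
  exists n, exists2 delta, 0 < delta &
  forall d (T : measurableType d) (P : probability T R) (a : T -> R) (mu : nat -> R),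
    measurable_fun setT a -> (forall x, 0 <= a x <= 1) ->
    (forall k, \int[P]_x (a x ^+ k)%:E = (mu k)%:E)%E ->
    (forall k, (k < n)%N -> `|mu k - k.+1%:R^-1| <= delta) ->
    `|fine (P [set x | a x < c]) - c| <= e.
Proof.
move=> /andP[c0 c1] e0.
pose f := e / 4.
have f0 : 0 < f by rewrite divr_gt0.
have coef_bound p : exists2 delta, 0 < delta & forall mu : nat -> R,
    (forall k, (k < size p)%N -> `|mu k - k.+1%:R^-1| <= delta) ->
    `|\sum_(i < size p) p`_i * mu i - unit_mean p| <= f.
  have s0 : 0 <= \sum_(i < size p) `|p`_i| by exact: sumr_ge0.
  exists (f / (\sum_(i < size p) `|p`_i| + 1)) => [|mu hmu].
    by rewrite divr_gt0// ltr_wpDl.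
  rewrite /unit_mean -sumrB; apply: (le_trans (ler_norm_sum _ _ _)).
  apply: (@le_trans _ _ (\sum_(i < size p) `|p`_i| * (f / (\sum_(i < size p) `|p`_i| + 1)))).
    by apply: ler_sum => i _; rewrite -mulrBr normrM ler_wpM2l// hmu.
  rewrite -mulr_suml mulrCA ler_piMr ?(ltW f0)// ler_pdivrMr ?ltr_wpDl//.
  by rewrite mul1r lerDl.
have prob_lt d (T : measurableType d) (P : probability T R) (a : T -> R) :
    measurable_fun setT a ->
    exists2 S, P [set x | a x < c] = S%:E & 0 <= S <= 1.
  move=> ma; have mA := measurable_lt_cst ma c.
  exists (fine (P [set x | a x < c])); first by rewrite fineK// fin_num_measure.
  rewrite fine_ge0 ?measure_ge0//= -lee_fin fineK ?fin_num_measure//.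
  exact: probability_le1.
(* The polynomial p drops before c: it bounds the distribution function from below. *)
pose x0 := Num.max 0 (c - f).
have x00 : 0 <= x0 by rewrite le_max lexx.
have x0c : x0 < c by rewrite gt_max c0/= ltrBlDr ltrDl.
have [p pP] := step_polynomial x00 x0c c1 f0.
have [d1 d10 hd1] := coef_bound p.
have p_mean : (1 - f) * x0 <= unit_mean p.
  have := @primitive_increment _ p 0 x0 (1 - f) 1 x00.
  have := @primitive_increment _ p x0 1 0 1 (le_trans (ltW x0c) c1).
  rewrite primitive0 primitive1 !subr0 mul0r => h1 h2.
  have /andP[h1' _] : 0 <= unit_mean p - (primitive p).[x0] <= 1 * (1 - x0).
    apply: h1 => z /andP[z0 z1]; have [|//] := pP z.
    by rewrite z1 (le_trans x00).
  have /andP[h2' _] : (1 - f) * x0 <= (primitive p).[x0] <= 1 * x0.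
    apply: h2 => z /andP[z0 z1]; have [|/andP[_ ->] -> //] := pP z.
    by rewrite z0 (le_trans z1)// ltW// (lt_le_trans x0c).
  lra.
have low d (T : measurableType d) (P : probability T R) (a : T -> R) mu :
    measurable_fun setT a -> (forall x, 0 <= a x <= 1) ->
    (forall k, \int[P]_x (a x ^+ k)%:E = (mu k)%:E)%E ->
    (forall k, (k < size p)%N -> `|mu k - k.+1%:R^-1| <= d1) ->
    c - e <= fine (P [set x | a x < c]).
  move=> ma a01 hmu /hd1; rewrite ler_norml => /andP[hp _].
  have [S SE /andP[S0 S1]] := prob_lt _ _ P _ ma; rewrite SE /=.
  have : \sum_(i < size p) p`_i * mu i <= S + f.
    rewrite -lee_fin -(integral_polynomial ma a01 _ hmu) EFinD -SE.
    rewrite -[f%:E]mule1 -(probability_setT P) -integral_cst//.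
    rewrite -[X in P X]setIT -integral_indic//; last exact: measurable_lt_cst.
    rewrite -ge0_integralD//; last 2 first.
    - by apply/measurable_EFinP; apply: measurable_indic; exact: measurable_lt_cst.
    - by move=> x _; rewrite lee_fin ltW.
    apply: ge0_le_integral => //.
    - by move=> x _; rewrite lee_fin; have [/andP[]] := pP _ (a01 x).
    - exact: measurable_polynomial.
    - apply: emeasurable_funD => //; apply/measurable_EFinP.
      by apply: measurable_indic; exact: measurable_lt_cst.
    - move=> x _; rewrite -EFinD lee_fin indicE; have [/andP[p0 p1] _ p2] := pP _ (a01 x).
      have [ac|ac] := ltP (a x) c.
        by rewrite mem_set// (le_trans p1)// lerDl ltW.
      by rewrite memNset ?add0r ?p2//= ltNge ac.
  have : c - f <= x0 by rewrite le_max lexx orbT.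
  have : f * x0 <= f by rewrite ler_piMr ?(ltW f0)// (le_trans (ltW x0c)).
  rewrite /f in hp p_mean *; lra.
have [c_eq1|c_lt1] := leP 1 c.
  exists (size p), d1 => // d T P a mu ma a01 hmu h.
  have hl := low _ _ _ _ _ ma a01 hmu h.
  have [S SE /andP[S0 S1]] := prob_lt _ _ P _ ma; rewrite SE /= in hl *.
  by rewrite ler_norml; apply/andP; split; lra.
(* The polynomial r drops after c. *)
pose x1 := Num.min 1 (c + f).
have cx1 : c < x1 by rewrite lt_min c_lt1/= ltrDl.
have x11 : x1 <= 1 by rewrite ge_min lexx.
have [r rP] := step_polynomial (ltW c0) cx1 x11 f0.
have [d2 d20 hd2] := coef_bound r.
have x10 : 0 <= x1 by rewrite ltW// (lt_trans c0).
have r_mean : unit_mean r <= x1 + f.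
  have := @primitive_increment _ r 0 x1 0 1 x10.
  have := @primitive_increment _ r x1 1 0 f x11.
  rewrite primitive0 primitive1 !subr0 !mul0r mul1r => h1 h2.
  have /andP[_ h1'] : 0 <= unit_mean r - (primitive r).[x1] <= f * (1 - x1).
    apply: h1 => z /andP[z0 z1]; have [|/andP[-> _] _ ->//] := rP z.
    by rewrite z1 (le_trans x10).
  have /andP[_ h2'] : 0 <= (primitive r).[x1] <= x1.
    apply: h2 => z /andP[z0 z1]; have [|//] := rP z.
    by rewrite z0 (le_trans z1).
  have : 0 <= f * x1 by rewrite mulr_ge0// ltW.
  lra.
exists (maxn (size p) (size r)), (Num.min d1 d2); first by rewrite lt_min d10.
move=> d T P a mu ma a01 hmu h.
have hl : c - e <= fine (P [set x | a x < c]).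
  apply: (low _ _ _ _ mu) => // k kp; apply: (le_trans (h _ _)); first by rewrite leq_max kp.
  by rewrite ge_min lexx.
have /ler_normlP[_ hr] : `|\sum_(i < size r) r`_i * mu i - unit_mean r| <= f.
  apply: hd2 => k kr; apply: (le_trans (h _ _)); first by rewrite leq_max kr orbT.
  by rewrite ge_min lexx orbT.
have [S SE /andP[S0 S1]] := prob_lt _ _ P _ ma; rewrite SE /= in hl *.
have : S <= \sum_(i < size r) r`_i * mu i + f.
  rewrite -lee_fin EFinD -(integral_polynomial ma a01 _ hmu) -SE.
  rewrite -[f%:E]mule1 -(probability_setT P) -integral_cst//.
  rewrite -[X in P X]setIT -integral_indic//; last exact: measurable_lt_cst.
  have mr := measurable_polynomial ma r.
  have r0 x : [set: T] x -> (0 <= (r.[a x])%:E)%E.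
    by move=> _; rewrite lee_fin; have [/andP[]] := rP _ (a01 x).
  rewrite -ge0_integralD//; last by move=> x _; rewrite lee_fin ltW.
  apply: ge0_le_integral => //.
  - by apply/measurable_EFinP; apply: measurable_indic; exact: measurable_lt_cst.
  - exact: emeasurable_funD.
  - move=> x _; rewrite -EFinD lee_fin indicE; have [/andP[p0 p1] p2 _] := rP _ (a01 x).
    have [ac|ac] := ltP (a x) c.
      by rewrite mem_set//= -lerBlDr p2// ltW.
    by rewrite memNset/= ?addr_ge0// ?ltW//; apply/negP; rewrite -leNgt.
have : x1 <= c + f by rewrite ge_min lexx orbT.
have fe : f = e / 4 by [].
by move=> ? ?; rewrite ler_norml; apply/andP; split; lra.
Qed.

End moments.

(** * Integrals against an exponential holding time *)

Section exponential_time.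
Context {R : realType} d (T : measurableType d) (P : probability T R).
Variables (Z tau : T -> R) (D q : R).
Hypotheses (mZ : measurable_fun setT Z) (Z0 : forall x, 0 <= Z x).
Hypotheses (mtau : measurable_fun setT tau) (tau0 : forall x, 0 < tau x).
Hypotheses (D0 : 0 <= D) (q0 : 0 < q).

(** Under the weight [Z], the time [tau] is exponential of rate [q]. *)
Hypothesis tail : forall s : R, 0 <= s ->
  (\int[P]_x (Z x * (s < tau x)%R%:R)%:E = (D * expR (- (q * s)))%:E)%E.

Local Notation leb := (@lebesgue_measure R).

(** When [phi] is the primitive of [w], write [phi (tau x)] as the integral of [w]
    over the levels [s < tau x] and exchange the integrals over [x] and [s]. *)
Lemma integral_tail (w phi : R -> R) (W : R) :
  measurable_fun setT w -> (forall s, 0 <= w s) -> (forall s, s < 0 -> w s = 0) ->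
  (forall a : R, (0 < a)%R -> \int[leb]_s (w s * (s < a)%R%:R)%:E = (phi a)%:E)%E ->
  (\int[leb]_s (w s * expR (- (q * s)))%:E = W%:E)%E ->
  (\int[P]_x (Z x * phi (tau x))%:E = (D * W)%:E)%E.
Proof.
move=> mw w0 wneg wphi wW.
pose f (xs : T * R) : \bar R := (Z xs.1 * (w xs.2 * (xs.2 < tau xs.1)%R%:R))%:E.
have mlt : measurable_fun setT (fun xs : T * R => ((xs.2 < tau xs.1)%R%:R : R)).
  rewrite (_ : (fun _ => _) = (fun xs : T * R => if xs.2 < tau xs.1 then 1 else 0)); last first.
    by apply/funext => xs; case: ifP.
  apply: measurable_fun_ifT => //; apply: measurable_fun_ltr; first exact: measurable_snd.
  exact: measurableT_comp.
have mf : measurable_fun setT f.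
  apply/measurable_EFinP; apply: measurable_funM; first exact: measurableT_comp.
  by apply: measurable_funM => //; exact: measurableT_comp.
have f0 xs : (0 <= f xs)%E by rewrite lee_fin mulr_ge0// mulr_ge0.
have mlt1 a : measurable_fun setT (fun s : R => (s < a)%R%:R : R).
  rewrite (_ : (fun _ => _) = (fun s : R => if s < a then 1 else 0)); last first.
    by apply/funext => s; case: ifP.
  by apply: measurable_fun_ifT => //; apply: measurable_fun_ltr.
have mlt2 s : measurable_fun setT (fun x : T => (s < tau x)%R%:R : R).
  rewrite (_ : (fun _ => _) = (fun x => if s < tau x then 1 else 0)); last first.
    by apply/funext => x; case: ifP.
  by apply: measurable_fun_ifT => //; apply: measurable_fun_ltr.
have := fubini_tonelli (m1 := P) (m2 := leb) f mf f0.
under eq_integral => x _.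
  rewrite /f /=; under eq_integral do rewrite EFinM.
  rewrite ge0_integralZl_EFin//; last 2 first.
    by move=> s _; rewrite lee_fin mulr_ge0.
    by apply/measurable_EFinP; apply: measurable_funM => //; exact: mlt1.
  rewrite wphi// -EFinM.
  over.
move=> ->.
under eq_integral => s _.
  rewrite /f /=.
  have -> : (\int[P]_x (Z x * (w s * (s < tau x)%R%:R))%:E = D%:E * (w s * expR (- (q * s)))%:E)%E.
    have [s0|s0] := ltP s 0.
      by rewrite wneg//; under eq_integral do rewrite mul0r mulr0; rewrite integral0 mul0r mule0.
    under eq_integral do rewrite mulrCA EFinM.
    rewrite ge0_integralZl_EFin//; last 2 first.
      by move=> x _; rewrite lee_fin mulr_ge0.
      by apply/measurable_EFinP; apply: measurable_funM => //; exact: mlt2.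
    by rewrite tail// -!EFinM; congr (_%:E); ring.
  over.
rewrite ge0_integralZl_EFin//; last 2 first.
  by move=> s _; rewrite lee_fin mulr_ge0// expR_ge0.
  apply/measurable_EFinP; apply: measurable_funM => //.
  apply: measurableT_comp; first exact: measurable_expR.
  by apply: measurableT_comp => //; exact: mulrl_measurable.
by rewrite wW -EFinM.
Qed.

Let expdf_times theta s : 0 <= theta ->
  exponential_pdf theta s * expR (- (q * s)) =
  theta / (q + theta) * exponential_pdf (q + theta) s.
Proof.
move=> t0; have qt : 0 < q + theta by rewrite ltr_pwDl.
have [s0|s0] := ltP s 0; first by rewrite !lt0_exponential_pdf// mul0r mulr0.
rewrite !exponential_pdfE// -mulrA -expRD mulrA divfK ?gt_eqF//.
by congr (_ * expR _); ring.
Qed.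

(** The density [w] of the exponential law of rate [theta] has the primitive
    [1 - exp (- theta * a)]. *)
Lemma integral_exponential_laplace theta : 0 <= theta ->
  (\int[P]_x (Z x * expR (- (theta * tau x)))%:E = (D * (q / (q + theta)))%:E)%E.
Proof.
rewrite le_eqVlt => /predU1P[<-|t0].
  under eq_integral do rewrite mul0r oppr0 expR0.
  rewrite addr0 divff ?gt_eqF//; have := tail (lexx 0); rewrite !mulr0 oppr0 expR0 => <-.
  by apply: eq_integral => x _; rewrite tau0.
have qt : 0 < q + theta by rewrite addr_gt0.
have H : (\int[P]_x (Z x * (1 - expR (- (theta * tau x))))%:E = (D * (theta / (q + theta)))%:E)%E.
  apply: (@integral_tail (exponential_pdf theta) (fun a => 1 - expR (- (theta * a)))).
  - exact: measurable_exponential_pdf.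
  - by move=> s; apply: exponential_pdf_ge0; exact: ltW.
  - by move=> s s0; rewrite lt0_exponential_pdf.
  - move=> a a0; have := exponential_prob_itv0c theta a0.
    rewrite /exponential_prob -integral_itv_bndo_bndc; last first.
      by apply/measurable_EFinP; apply: measurable_funTS; exact: measurable_exponential_pdf.
    rewrite -EFinB mulNr => <-; rewrite [RHS]integral_mkcond; apply: eq_integral => s _.
    rewrite patchE; case: ifPn => [|].
      by rewrite inE/= in_itv/= => /andP[_ ->]; rewrite mulr1.
    rewrite notin_setE/= in_itv/= => /negP; rewrite negb_and -!ltNge -leNgt => /orP[s0|sa].
      by rewrite lt0_exponential_pdf// mul0r.
    by rewrite ltNge sa mulr0.
  - under eq_integral do rewrite expdf_times ?(ltW t0)// EFinM.
    rewrite ge0_integralZl_EFin ?integral_exponential_pdf ?mule1//.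
    + by move=> s _; rewrite lee_fin exponential_pdf_ge0// ltW.
    + by apply/measurable_EFinP; exact: measurable_exponential_pdf.
    + by rewrite divr_ge0// ltW.
have ZD : (\int[P]_x (Z x)%:E = D%:E)%E.
  have := tail (lexx 0); rewrite mulr0 oppr0 expR0 mulr1 => <-.
  by apply: eq_integral => x _; rewrite tau0 mulr1.
have mexp : measurable_fun setT (fun x => expR (- (theta * tau x))).
  apply: measurableT_comp; first exact: measurable_expR.
  by apply: measurableT_comp => //; apply: measurable_funM.
have S : (\int[P]_x (Z x * (1 - expR (- (theta * tau x))))%:E +
   \int[P]_x (Z x * expR (- (theta * tau x)))%:E = D%:E)%E.
  rewrite -ge0_integralD//.
  - by rewrite -ZD; apply: eq_integral => x _; rewrite -EFinD; congr (_%:E); ring.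
  - move=> x _; rewrite lee_fin mulr_ge0// subr_ge0 -[leRHS]expR0 ler_expR oppr_le0.
    by rewrite mulr_ge0// ltW.
  - by apply/measurable_EFinP; apply: measurable_funM => //; exact: measurable_funB.
  - by move=> x _; rewrite lee_fin mulr_ge0// expR_ge0.
  - by apply/measurable_EFinP; exact: measurable_funM.
move: S; rewrite H; set I := (\int[P]_x _)%E => /eqP.
rewrite addeC eq_sym -sube_eq// => [/eqP<-|]; last by rewrite ?fin_num_adde_defl.
rewrite -EFinB; congr (_%:E); field; exact: lt0r_neq0.
Qed.

Lemma integral_exponential_mean :
  (\int[P]_x (Z x * tau x)%:E = (D / q)%:E)%E.
Proof.
pose w : R -> R := \1_(`[0, +oo[).
apply: (@integral_tail w id).
- exact: measurable_indic.
- by move=> s; rewrite /w indicE.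
- by move=> s s0; rewrite /w indicE memNset//= in_itv/= andbT leNgt s0.
- move=> a a0; rewrite (_ : a%:E = leb `[0, a[); last first.
    by rewrite lebesgue_measure_itv/= lte_fin a0 sube0.
  rewrite -[X in _ = leb X]setIT -integral_indic//; apply: eq_integral => s _.
  congr (_%:E); rewrite /w !indicE -natrM mulnb; congr (_%:R); congr nat_of_bool.
  have -> : (s \in (`[0, +oo[%classic : set R)) = (0 <= s).
    by apply/idP/idP; rewrite inE/= in_itv/= andbT.
  by apply/idP/idP; rewrite inE/= in_itv.
- under eq_integral => s _.
    have -> : (w s * expR (- (q * s)))%:E = ((q^-1)%:E * (exponential_pdf q s)%:E)%E.
     rewrite -EFinM; congr (_%:E).
    have [s0|s0] := ltP s 0.
      by rewrite lt0_exponential_pdf// /w indicE memNset ?mul0r ?mulr0//= in_itv/= andbT leNgt s0.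
    rewrite exponential_pdfE// /w indicE mem_set ?mul1r/= ?in_itv/= ?s0//.
    by rewrite mulrA mulVf ?gt_eqF// mul1r mulNr.
    over.
  rewrite ge0_integralZl_EFin ?integral_exponential_pdf ?mule1//.
  + by move=> s _; rewrite lee_fin exponential_pdf_ge0// ltW.
  + by apply/measurable_EFinP; exact: measurable_exponential_pdf.
  + by rewrite invr_ge0 ltW.
Qed.

End exponential_time.

(** * Expectations along a jump chain with exponential holding times *)

Section holding_times.
Context {R : realType} {S : countType} d (T : measurableType d) (P : probability T R).
Variables (Y : nat -> T -> S) (tau : nat -> T -> R).
Variables (Q : S -> R) (p : S -> S -> R) (u0 : S).
Hypothesis mY : forall i z, measurable [set x | Y i x = z].
Hypothesis mtau : forall i, measurable_fun setT (tau i).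
Hypothesis tau0 : forall i x, 0 < tau i x.
Hypothesis Q0 : forall u, 0 < Q u.
Hypothesis p0 : forall u w, 0 <= p u w.
Hypothesis law : forall n (y : nat -> S) (t : nat -> R), (forall i, 0 <= t i) ->
  P [set x | forall i, (i <= n)%N -> Y i x = y i /\ t i < tau i x] =
  ((y 0%N == u0)%:R * (\prod_(0 <= i < n) p (y i) (y i.+1)) *
   \prod_(0 <= i < n.+1) expR (- (Q (y i) * t i)))%:E.

Implicit Types (y : nat -> S) (t : nat -> R) (x : T).

Definition survive n y t : set T :=
  [set x | forall i, (i <= n)%N -> Y i x = y i /\ t i < tau i x].
Definition follow n y : set T := [set x | forall i, (i <= n)%N -> Y i x = y i].
Definition path_prob n y : R :=
  (y 0%N == u0)%:R * \prod_(0 <= i < n) p (y i) (y i.+1).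

Let measurable_and (A : nat -> set T) n : (forall i, measurable (A i)) ->
  measurable [set x | forall i, (i <= n)%N -> A i x].
Proof.
move=> mA; rewrite (_ : [set x | _] = \bigcap_(i in [set i | (i <= n)%N]) A i).
  by apply: bigcap_measurable => //; exists 0%N.
by apply/seteqP; split=> x h i /= /h.
Qed.

Lemma measurable_survive n y t : measurable (survive n y t).
Proof.
apply: (@measurable_and (fun i => [set x | Y i x = y i /\ t i < tau i x])) => i.
rewrite (_ : [set x | _] = [set x | Y i x = y i] `&` (tau i @^-1` `]t i, +oo[)).
  apply: measurableI => //; rewrite -[X in measurable X]setTI; exact: mtau.
by apply/seteqP; split=> x /=; rewrite in_itv/= andbT.
Qed.

Lemma measurable_follow n y : measurable (follow n y).
Proof. by apply: (@measurable_and (fun i => [set x | Y i x = y i])) => i; exact: mY. Qed.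

Lemma path_prob_ge0 n y : 0 <= path_prob n y.
Proof. by rewrite mulr_ge0// prodr_ge0. Qed.

Lemma survive_follow n y : survive n y (fun=> 0) = follow n y.
Proof.
apply/seteqP; split=> x h i /h; first by case.
by split => //; exact: tau0.
Qed.

Lemma follow_prob n y : P (follow n y) = (path_prob n y)%:E.
Proof.
rewrite -survive_follow [LHS](law n y (fun=> lexx 0)) [X in _ * X]big1 ?mulr1// => i _.
by rewrite mulr0 oppr0 expR0.
Qed.

Section discounted.
Variable theta : R.
Hypothesis theta0 : 0 <= theta.

Definition damping k x : R := \prod_(0 <= i < k) expR (- (theta * tau i x)).
Definition discount_ratio u : R := Q u / (Q u + theta).

Lemma damping_ge0 k x : 0 <= damping k x.
Proof. by apply: prodr_ge0 => i _; exact: expR_ge0. Qed.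

Lemma measurable_damping k : measurable_fun setT (damping k).
Proof.
rewrite /damping; apply: measurable_prod => i _.
apply: measurableT_comp; first exact: measurable_expR.
by apply: measurableT_comp => //; exact: measurable_funM.
Qed.

Lemma discount_ratio_ge0 u : 0 <= discount_ratio u.
Proof. by rewrite divr_ge0 ?addr_ge0// ltW. Qed.

Definition upd (f : nat -> R) k s i : R := if i == k then s else f i.

(** The joint law is given in terms of the tails of the holding times. They are
    turned into Laplace transforms one after the other: [k] of them are done,
    and their levels [t i] are set to [0], where the tail event is certain. *)
Lemma integral_damping_survive n y k t : (k <= n.+1)%N -> (forall i, 0 <= t i) ->
  (forall i, (i < k)%N -> t i = 0) ->
  (\int[P]_x (damping k x * \1_(survive n y t) x)%:E =
   (path_prob n y * \prod_(0 <= i < k) discount_ratio (y i) *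
    \prod_(0 <= i < n.+1) expR (- (Q (y i) * t i)))%:E)%E.
Proof.
elim: k t => [|k IH] t kn t0 tk.
  rewrite /damping; under eq_integral do rewrite big_geq// mul1r.
  rewrite integral_indic//; last exact: measurable_survive.
  by rewrite setIT [LHS](law n y t0) (big_geq (leqnn 0)) mulr1.
have kn' : (k <= n)%N by [].
set Dk := path_prob n y * \prod_(0 <= i < k) discount_ratio (y i) *
  \prod_(0 <= i < n.+1) expR (- (Q (y i) * t i)).
have D0 : 0 <= Dk.
  apply: mulr_ge0; last by apply: prodr_ge0 => i _; exact: expR_ge0.
  apply: mulr_ge0; first exact: path_prob_ge0.
  by apply: prodr_ge0 => i _; exact: discount_ratio_ge0.
have msurv : measurable_fun setT (\1_(survive n y t) : T -> R).
  by apply: measurable_indic; exact: measurable_survive.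
have mZ : measurable_fun setT (fun x => damping k x * \1_(survive n y t) x).
  by apply: measurable_funM => //; exact: measurable_damping.
have Z0 x : 0 <= damping k x * \1_(survive n y t) x.
  by rewrite mulr_ge0 ?damping_ge0// indicE.
have tail s : 0 <= s ->
    (\int[P]_x (damping k x * \1_(survive n y t) x * (s < tau k x)%R%:R)%:E =
     (Dk * expR (- (Q (y k) * s)))%:E)%E.
  move=> s0.
  have upd0 i : 0 <= upd t k s i by rewrite /upd; case: eqP.
  have updk i : (i < k)%N -> upd t k s i = 0.
    by move=> ik; rewrite /upd ltn_eqF// tk// ltnS ltnW.
  have := IH (upd t k s) (leqW kn') upd0 updk.
  have -> : \prod_(0 <= i < n.+1) expR (- (Q (y i) * upd t k s i)) =
      \prod_(0 <= i < n.+1) expR (- (Q (y i) * t i)) * expR (- (Q (y k) * s)).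
    rewrite !big_mkord (bigD1 (Ordinal (kn : (k < n.+1)%N)))//=.
    rewrite [in RHS](bigD1 (Ordinal (kn : (k < n.+1)%N)))//= tk// mulr0 oppr0 expR0 mul1r.
    rewrite /upd eqxx mulrC; congr (_ * _); apply: eq_bigr => i ik.
    by rewrite ifF//; apply: contra_neqF ik => /eqP ik; exact/val_inj.
  rewrite /Dk !mulrA => <-; apply: eq_integral => x _.
  congr (_%:E); rewrite -mulrA; congr (_ * _).
  rewrite !indicE -natrM mulnb; congr (_%:R); congr nat_of_bool.
  apply/idP/idP.
    move=> /andP[/set_mem h sx]; apply/mem_set => i ik; have [-> ti] := h _ ik.
    by rewrite /upd; case: eqP => // ->.
  move=> /set_mem h; apply/andP; split.
    apply/mem_set => i ik; have [-> ti] := h _ ik; split=> //.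
    move: ti; rewrite /upd; case: eqP => // -> _.
    by rewrite tk.
  by have [_] := h _ kn'; rewrite /upd eqxx.
have := integral_exponential_laplace mZ Z0 (mtau k) (tau0 k) D0 (Q0 (y k)) tail theta0.
rewrite big_nat_recr//= -/(discount_ratio _) /Dk => H.
transitivity (\int[P]_x (damping k x * \1_(survive n y t) x * expR (- (theta * tau k x)))%:E)%E.
  by apply: eq_integral => x _; rewrite /damping big_nat_recr//= mulrAC.
by rewrite H; congr (_%:E); ring.
Qed.

Definition path_weight n y : R := path_prob n y * \prod_(0 <= i < n) discount_ratio (y i).

Let on_set (A : set T) (f : T -> R) : measurable A ->
  (\int[P]_(x in A) (f x)%:E = \int[P]_x (f x * \1_A x)%:E)%E.
Proof.
move=> mA; rewrite integral_mkcond; apply: eq_integral => x _.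
by rewrite patchE indicE; case: ifP; rewrite ?mulr1 ?mulr0.
Qed.

Lemma integral_damping n y :
  (\int[P]_(x in follow n y) (damping n x)%:E = (path_weight n y)%:E)%E.
Proof.
rewrite on_set; last exact: measurable_follow.
rewrite -survive_follow integral_damping_survive// /path_weight.
by rewrite [X in _ * X]big1 ?mulr1// => i _; rewrite mulr0 oppr0 expR0.
Qed.

Lemma integral_damping_time n y :
  (\int[P]_(x in follow n y) (damping n x * tau n x)%:E =
   (path_weight n y / Q (y n))%:E)%E.
Proof.
rewrite on_set; last exact: measurable_follow.
have mfol : measurable_fun setT (\1_(follow n y) : T -> R).
  by apply: measurable_indic; exact: measurable_follow.
have mZ : measurable_fun setT (fun x => damping n x * \1_(follow n y) x).
  by apply: measurable_funM => //; exact: measurable_damping.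
have Z0 x : 0 <= damping n x * \1_(follow n y) x.
  by rewrite mulr_ge0 ?damping_ge0// indicE.
have tail s : 0 <= s ->
    (\int[P]_x (damping n x * \1_(follow n y) x * (s < tau n x)%R%:R)%:E =
     (path_weight n y * expR (- (Q (y n) * s)))%:E)%E.
  move=> s0; have upd0 i : 0 <= upd (fun=> 0) n s i by rewrite /upd; case: eqP.
  have updn i : (i < n)%N -> upd (fun=> 0) n s i = 0 by move=> ik; rewrite /upd ltn_eqF.
  have E : \prod_(0 <= i < n.+1) expR (- (Q (y i) * upd (fun=> 0) n s i)) =
      expR (- (Q (y n) * s)).
    rewrite big_nat_recr//= [X in X * _]big_nat big1 ?mul1r ?/upd ?eqxx// => i /andP[_ ik].
    by rewrite ltn_eqF// mulr0 oppr0 expR0.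
  have := integral_damping_survive y (leqnSn n) upd0 updn; rewrite E.
  move=> <-; apply: eq_integral => x _; congr (_%:E).
  rewrite -mulrA; congr (_ * _).
  rewrite !indicE -natrM mulnb; congr (_%:R); congr nat_of_bool.
  apply/idP/idP.
    move=> /andP[/set_mem h sx]; apply/mem_set => i ik; rewrite h//; split=> //.
    by rewrite /upd; case: eqP => [->|_] //; exact: tau0.
  move=> /set_mem h; apply/andP; split; first by apply/mem_set => i ik; have [] := h _ ik.
  by have [_] := h _ (leqnn n); rewrite /upd eqxx.
have W0 : 0 <= path_weight n y.
  by rewrite mulr_ge0 ?path_prob_ge0// prodr_ge0// => i _; exact: discount_ratio_ge0.
have := integral_exponential_mean mZ Z0 (mtau n) (tau0 n) W0 (Q0 (y n)) tail.
by move=> <-; apply: eq_integral => x _; rewrite mulrAC.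
Qed.

Section chain.
Variable supp : S -> seq S.
Hypothesis supp_uniq : forall u, uniq (supp u).
Hypothesis supp1 : forall u, \sum_(w <- supp u) p u w = 1.
Variable chi : S -> R.
Hypothesis chi0 : forall u, 0 <= chi u.
Hypothesis mchi : forall i, measurable_fun setT (fun x => chi (Y i x)).

Definition weighted_step (f : S -> R) u : R :=
  chi u * discount_ratio u * \sum_(w <- supp u) p u w * f w.

Definition extend y k w i : S := if i == k.+1 then w else y i.

Lemma follow_extend k y w :
  follow k.+1 (extend y k w) = follow k y `&` [set x | Y k.+1 x = w].
Proof.
apply/seteqP; split=> x.
  move=> h; split=> [i ik|]; last by have /= -> := h _ (leqnn _); rewrite /extend eqxx.
  by rewrite h ?(leqW ik)// /extend ltn_eqF.
move=> [h hw] i; rewrite leq_eqVlt ltnS => /predU1P[->|ik]; rewrite /extend ?eqxx//.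
by rewrite ltn_eqF// h.
Qed.

Let prod_extend k y w (f : S -> S -> R) :
  \prod_(0 <= i < k) f (extend y k w i) (extend y k w i.+1) = \prod_(0 <= i < k) f (y i) (y i.+1).
Proof.
rewrite big_nat [RHS]big_nat; apply: eq_bigr => i /andP[_ ik].
by rewrite /extend !ltn_eqF// ltnS ltnW.
Qed.

Lemma path_prob_extend k y w :
  path_prob k.+1 (extend y k w) = path_prob k y * p (y k) w.
Proof.
rewrite /path_prob big_nat_recr//= prod_extend mulrA.
by rewrite /extend eqxx !ltn_eqF.
Qed.

Lemma path_weight_extend k y w :
  path_weight k.+1 (extend y k w) = path_weight k y * discount_ratio (y k) * p (y k) w.
Proof.
rewrite /path_weight path_prob_extend big_nat_recr//=.
rewrite (prod_extend k y w (fun u _ => discount_ratio u)) /extend ltn_eqF//.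
by ring.
Qed.

(** The events on the right are disjoint, and their probabilities add up to that of
    [follow k y] because [p (y k)] has mass [1] on the support. *)
Lemma integral_next k y (f : T -> \bar R) : measurable_fun setT f ->
  (forall x, (0 <= f x)%E) ->
  (\int[P]_(x in follow k y) f x =
   \sum_(w <- supp (y k)) \int[P]_(x in follow k.+1 (extend y k w)) f x)%E.
Proof.
move=> mf f0.
pose F w := follow k.+1 (extend y k w).
have mF w : measurable (F w) by exact: measurable_follow.
have tF : trivIset [set` supp (y k)] F.
  move=> w w' _ _; rewrite /F !follow_extend => -[x [[_ <-] [_ <-]]] //.
pose U := \big[setU/set0]_(w <- supp (y k)) F w.
have mU : measurable U by apply: bigsetU_measurable => w _; exact: mF.
have UF : U `<=` follow k y.
  rewrite /U; elim/big_ind : _ => // [A B AF BF x [/AF|/BF]//|w _].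
  by rewrite /F follow_extend => x [].
pose N := follow k y `\` U.
have mN : measurable N by apply: measurableD => //; exact: measurable_follow.
have PU : P U = P (follow k y).
  rewrite -[LHS]mul1e -integral_cst// /U ge0_integral_bigsetU//.
  transitivity (\sum_(w <- supp (y k)) (path_prob k y * p (y k) w)%:E)%E.
    apply: eq_bigr => w _; rewrite integral_cst// mul1e -path_prob_extend.
    exact: follow_prob.
  by rewrite sumEFin -mulr_sumr supp1 mulr1 follow_prob.
have PN : P N = 0%E.
  have fol_fin : P (follow k y) \is a fin_num.
    by apply: fin_num_measure; exact: measurable_follow.
  have -> : P N = (P (follow k y) - P (follow k y `&` U))%E.
    apply: measureD; [exact: measurable_follow|exact: mU|].
    by rewrite -ge0_fin_numE.
  by rewrite (setIidr UF) [P U]PU subee.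
have -> : follow k y = U `|` N by rewrite /N setUDr setDv setD0; apply/esym/setUidPr.
rewrite ge0_integral_setU//; last 2 first.
  exact: measurable_funTS.
  by apply/eqP; rewrite setIDA setIC -setIDA setDv setI0.
rewrite (null_set_integral mN (measurable_funTS mf) PN) adde0.
by rewrite ge0_integral_bigsetU//; exact: measurable_funTS.
Qed.

Definition survival k n x : R := \prod_(k <= i < n) chi (Y i x).

Lemma survival_ge0 k n x : 0 <= survival k n x.
Proof. exact: prodr_ge0. Qed.

Lemma measurable_survival k n : measurable_fun setT (survival k n).
Proof. by rewrite /survival; apply: measurable_prod. Qed.

Section functional.
Variables (n : nat) (G : T -> R) (F : S -> R).
Hypotheses (mG : measurable_fun setT G) (G0 : forall x, 0 <= G x).
Hypothesis FG : forall y,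
  (\int[P]_(x in follow n y) (damping n x * G x)%:E = (path_weight n y * F (y n))%:E)%E.

(** Markov property, by induction on the number [j] of steps to go: the state
    [Y k] is known on the event [follow k y], and one conditions on the next one. *)
Lemma integral_chain_from k j y : (k + j = n)%N ->
  (\int[P]_(x in follow k y) (damping n x * survival k n x * G x)%:E =
   (path_weight k y * iter j weighted_step F (y k))%:E)%E.
Proof.
elim: j k y => [|j IH] k y kj.
  rewrite addn0 in kj; rewrite kj -FG; apply: eq_integral => x _.
  by rewrite /survival big_geq// mulr1.
have kn : (k < n)%N by rewrite -kj addnS ltnS leq_addr.
have m1 : measurable_fun setT (fun x => (damping n x * survival k.+1 n x * G x)%:E).
  apply/measurable_EFinP; apply: measurable_funM => //; apply: measurable_funM.
    exact: measurable_damping.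
  exact: measurable_survival.
have m0 x : (0 <= (damping n x * survival k.+1 n x * G x)%:E)%E.
  by rewrite lee_fin !mulr_ge0 ?damping_ge0 ?survival_ge0.
transitivity ((chi (y k))%:E * \int[P]_(x in follow k y) (damping n x * survival k.+1 n x * G x)%:E)%E.
  rewrite -ge0_integralZl_EFin//; last 2 first.
  - exact: measurable_follow.
  - exact: measurable_funTS.
  apply: eq_integral => x /set_mem xF; rewrite -EFinM; congr (_%:E).
  rewrite {1}/survival big_ltn// -/(survival k.+1 n x) xF//; ring.
rewrite integral_next//.
under eq_bigr => w _.
  rewrite IH; last by rewrite -kj addSnnS.
  rewrite path_weight_extend /extend eqxx.
  over.
rewrite sumEFin -EFinM; congr (_%:E).
rewrite iterS /weighted_step !mulr_sumr; apply: eq_bigr => w _; ring.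
Qed.

Lemma integral_chain :
  (\int[P]_x (damping n x * survival 0 n x * G x)%:E =
   (iter n weighted_step F u0)%:E)%E.
Proof.
have m1 : measurable_fun setT (fun x => (damping n x * survival 0 n x * G x)%:E).
  apply/measurable_EFinP; apply: measurable_funM => //; apply: measurable_funM.
    exact: measurable_damping.
  exact: measurable_survival.
have mA : measurable (follow 0 (fun=> u0)) by exact: measurable_follow.
have PA : P (follow 0 (fun=> u0)) = 1%E.
  by rewrite follow_prob /path_prob eqxx big_geq// mulr1.
have PAc : P (~` follow 0 (fun=> u0)) = 0%E.
  by rewrite probability_setC// PA subee.
have m0 : (forall x, 0 <= (damping n x * survival 0 n x * G x)%:E)%E.
  by move=> x; rewrite lee_fin !mulr_ge0 ?damping_ge0 ?survival_ge0.
rewrite -(setvU (follow 0 (fun=> u0))) ge0_integral_setU//; last 3 first.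
- exact: measurableC.
- exact: measurable_funTS.
- by apply/eqP; rewrite setICl.
rewrite null_set_integral ?add0e; last 3 first.
- exact: measurableC.
- exact: measurable_funTS.
- exact: PAc.
rewrite (@integral_chain_from 0 n)// /path_weight /path_prob eqxx !big_geq//.
by rewrite !mul1r.
Qed.

End functional.
End chain.
End discounted.
End holding_times.

(** * The hitting time along a trajectory *)

(** The exponential of [- theta * z], with value [0] at infinity. *)
Definition exp_time {R : realType} (theta : R) (z : \bar R) : R :=
  if z is r%:E then expR (- (theta * r)) else 0.

Section trajectory.
Context {R : realType} {S : Type}.
Variables (C : set S) (U : R -> S) (y : nat -> S) (tau : nat -> R).
Hypothesis tau0 : forall i, 0 < tau i.
Hypothesis tau_dvg : (\sum_(0 <= i < n) tau i) @[n --> \oo] --> +oo.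
Hypothesis U_y : forall n t,
  \sum_(0 <= i < n) tau i <= t < \sum_(0 <= i < n.+1) tau i -> U t = y n.

Let J n := \sum_(0 <= i < n) tau i.

Let J_S n : J n.+1 = J n + tau n. Proof. by rewrite /J big_nat_recr. Qed.

Let J_nd m n : (m <= n)%N -> J m <= J n.
Proof.
move=> mn; rewrite /J [leRHS](big_cat_nat (n := m))//= lerDl.
by apply: sumr_ge0 => i _; exact: ltW.
Qed.

Let hit := ereal_inf [set t%:E | t in [set t : R | 0 < t /\ C (U t)]].

Let bracket t : 0 <= t -> exists n, J n <= t < J n.+1.
Proof.
move=> t0; have ex : exists n, t < J n.
  have : \forall n \near \oo, t < J n by move/cvgryPgt : tau_dvg; exact.
  by case=> n _ h; exists n; exact: h (leqnn n).
case: (ex_minnP ex) => -[|n] tn hn.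
  by move: tn; rewrite /J big_geq// ltNge t0.
exists n; rewrite tn andbT leNgt; apply/negP => /hn.
by rewrite ltnn.
Qed.

Let hit_finite k : C (y k) -> (forall i, (i < k)%N -> ~ C (y i)) -> hit = (J k)%:E.
Proof.
move=> Ck Ci; apply/eqP; rewrite eq_le; apply/andP; split.
  apply/lee_addgt0Pr => e e0; pose s := Num.min (e / 2) (tau k / 2).
  have s0 : 0 < s by rewrite lt_min !divr_gt0.
  have se : s < e by rewrite gt_min ltr_pdivrMr// mulr2n mulrDr mulr1 ltrDl e0.
  have st : s < tau k by rewrite gt_min orbC ltr_pdivrMr// mulr2n mulrDr mulr1 ltrDl tau0.
  apply: (@le_trans _ _ (J k + s)%:E); last by rewrite -EFinD lee_fin lerD2l ltW.
  apply: ereal_inf_lbound; exists (J k + s) => //; split.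
    by rewrite ltr_wpDl//; apply: sumr_ge0 => i _; exact: ltW.
  by rewrite (@U_y k)// -/(J k) -/(J k.+1) J_S lerDl ltrD2l (ltW s0).
apply: le_ereal_inf_tmp => _ [t [t0 Ct] <-]; rewrite lee_fin leNgt; apply/negP => tk.
have [n /andP[nt tn]] := bracket (ltW t0).
have nk : (n < k)%N.
  by rewrite ltnNge; apply/negP => /J_nd kn; move: (le_lt_trans nt tk); rewrite ltNge kn.
by apply: (Ci _ nk); rewrite -(@U_y n t)//; apply/andP; split.
Qed.

Let hit_infinite : (forall i, ~ C (y i)) -> hit = +oo%E.
Proof.
move=> Ci; rewrite /hit (_ : [set t%:E | t in _] = set0) ?ereal_inf0//.
apply/seteqP; split=> // _ [t [t0 Ct] <-].
have [n h] := bracket (ltW t0); apply: (Ci n).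
by rewrite -(@U_y n t).
Qed.

Let first_hit : (exists2 k, C (y k) & forall i, (i < k)%N -> ~ C (y i)) \/
  (forall i, ~ C (y i)).
Proof.
have [ex|nex] := pselect (exists k, `[< C (y k) >]); last first.
  by right=> i Ci; apply: nex; exists i; exact/asboolP.
left; case: (ex_minnP ex) => k /asboolP Ck hk; exists k => // i ik Ci.
by have := hk i (asboolT Ci); rewrite leqNgt ik.
Qed.

Let ind_hit i : C (y i) -> \1_(~` C) (y i) = 0 :> R.
Proof. by move=> Ci; rewrite indicE memNset// => /(_ Ci). Qed.
Let ind_nohit i : ~ C (y i) -> \1_(~` C) (y i) = 1 :> R.
Proof. by move=> Ci; rewrite indicE mem_set. Qed.
Let ind_C0 i : ~ C (y i) -> \1_C (y i) = 0 :> R.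
Proof. by move=> Ci; rewrite indicE memNset. Qed.

Let alive n : R := \prod_(0 <= i < n) \1_(~` C) (y i).

Let alive1 n : (forall i, (i < n)%N -> ~ C (y i)) -> alive n = 1.
Proof.
move=> h; rewrite /alive big_nat big1// => i /andP[_ /h Ci].
exact: ind_nohit.
Qed.

Let alive0 n k : (k < n)%N -> C (y k) -> alive n = 0.
Proof.
move=> kn Ck; rewrite /alive (big_cat_nat (n := k))//=; last exact: ltnW.
by rewrite [X in _ * X]big_ltn// ind_hit// mul0r mulr0.
Qed.

(** The hitting time is the total of the holding times up to the first visit to [C].
    If there is none, the divergence of this series is the absence of explosion. *)
Lemma hitting_time_series :
  hit = (\sum_(0 <= n <oo) (alive n * (\1_(~` C) (y n) * tau n))%:E)%E.
Proof.
have [[k Ck Ci]|Ci] := first_hit.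
  rewrite (hit_finite Ck Ci) (nneseries_split 0 k); last first.
    move=> n _; rewrite lee_fin mulr_ge0 ?prodr_ge0// mulr_ge0 ?indicE//; exact: ltW.
  rewrite add0n [X in (_ + X)%E]eseries0 ?adde0; last first.
    move=> n kn _; have [->|nk] := eqVneq n k.
      by rewrite ind_hit// mul0r mulr0.
    by rewrite (@alive0 n k) ?mul0r// ltn_neqAle eq_sym nk.
  rewrite /J -sumEFin big_nat [RHS]big_nat; apply: eq_bigr => i /andP[_ ik].
  rewrite alive1 ?mul1r; last by move=> j ji; apply: Ci; exact: ltn_trans ik.
  by rewrite ind_nohit ?mul1r//; exact: Ci.
rewrite (hit_infinite Ci); apply/esym/cvg_lim => //.
rewrite (_ : (fun n => _) = (fun n => (J n)%:E)); first exact/cvgeryP.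
apply/funext => n; rewrite sumEFin; congr (_%:E); apply: eq_bigr => i _.
by rewrite alive1 ?mul1r// ind_nohit ?mul1r//; exact: Ci.
Qed.

(** At most one term is not zero, the one of the first visit to [C]. *)
Lemma exp_time_series theta :
  (exp_time theta hit)%:E = (\sum_(0 <= n <oo)
    (\prod_(0 <= i < n) expR (- (theta * tau i)) * alive n * \1_C (y n))%:E)%E.
Proof.
have [[k Ck Ci]|Ci] := first_hit.
  rewrite (hit_finite Ck Ci) (nneseries_split 0 k.+1); last first.
    move=> n _; rewrite lee_fin !mulr_ge0 ?prodr_ge0 ?indicE// => i _; exact: expR_ge0.
  rewrite add0n [X in (_ + X)%E]eseries0 ?adde0; last first.
    by move=> n kn _; rewrite (alive0 kn Ck) mulr0 mul0r.
  rewrite big_nat_recr//= big_nat big1 ?add0e; last first.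
    by move=> i /andP[_ ik]; rewrite ind_C0 ?mulr0//; exact: Ci.
  rewrite alive1// indicE mem_set// !mulr1 /exp_time /J mulr_sumr -sumrN; congr (_%:E).
  by rewrite expR_sum.
rewrite (hit_infinite Ci) eseries0// => n _ _.
by rewrite ind_C0 ?mulr0//; exact: Ci.
Qed.

End trajectory.

(** * Law of the hitting time of the opinion process *)

Section opinion_process.
Context {R : realType} {N : nat}.
Variable beta : R.
Hypotheses (N_ge3 : (3 <= N)%N) (beta_ge0 : 0 <= beta).
Implicit Types (u w : state N).

Local Notation C := (@consensus_neg N).
Local Notation G := (generator beta).

Let N1 : (1 < N)%N. Proof. exact: leq_trans N_ge3. Qed.

Lemma exit_rateE u : exit_rate G u = total_rate beta u.
Proof.
rewrite exit_rate_generator// /total_rate sum_moves addrC big_bool/= addrC.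
by [].
Qed.

(** The matrix of the jump chain gathers the moves that lead to the same list. *)
Lemma jump_probE u w :
  jump_prob G u w = \sum_(i | speak u i == w) move_prob beta u i.
Proof.
rewrite /jump_prob; case: eqVneq => [->|uw].
  rewrite big_pred0// => i; apply/negbTE; exact: express_state_neq.
rewrite jump_rate_generator// exit_rateE mulr_suml.
under eq_bigr do rewrite mulr_suml.
by rewrite pair_big_dep.
Qed.

Definition neighbors u : seq (state N) := undup (codom (speak u)).

Lemma sum_jump_prob u (f : state N -> R) :
  \sum_(w <- neighbors u) jump_prob G u w * f w = avg (move_prob beta) speak f u.
Proof.
under eq_bigr do rewrite jump_probE mulr_suml.
rewrite (exchange_big_dep predT)//=; apply: eq_bigr => i _.
rewrite -big_filter (_ : [seq w <- neighbors u | speak u i == w] = [:: speak u i]).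
  by rewrite big_seq1.
rewrite -(@filter_pred1_uniq _ (neighbors u) (speak u i)) ?undup_uniq//.
  by apply: eq_filter => w; rewrite /= eq_sym.
by rewrite mem_undup codom_f.
Qed.

Lemma sum_jump_prob1 u : \sum_(w <- neighbors u) jump_prob G u w = 1.
Proof.
have := sum_jump_prob u (fun=> 1); rewrite avg_cst => [<-|w]; last exact: sum_move_prob.
by apply: eq_bigr => w _; rewrite mulr1.
Qed.

Variables (v : state N) (d : measure_display) (T : measurableType d).
Variables (P : probability T R) (U : R -> T -> state N).
Hypothesis process : markov_jump_process G v P U.

Let exit_gt0 u : 0 < exit_rate G u.
Proof. by rewrite exit_rateE total_rate_gt0. Qed.

Let jump_ge0 u w : 0 <= jump_prob G u w.
Proof. by rewrite jump_probE sumr_ge0// => i _; exact: move_prob_ge0. Qed.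

Let step_kill theta : weighted_step (exit_rate G) (jump_prob G) theta neighbors \1_(~` C)
  = kill (move_prob beta) speak (discount beta theta).
Proof.
apply/funext => f; apply/funext => u.
by rewrite /weighted_step sum_jump_prob /kill /discount /discount_ratio exit_rateE.
Qed.

Section trajectories.
Variables (Y : nat -> T -> state N) (tau : nat -> T -> R).
Hypothesis mY : forall i z, measurable [set x | Y i x = z].

Lemma measurable_state_fun (f : state N -> R) i : measurable_fun setT (fun x => f (Y i x)).
Proof.
move=> _ B mB; rewrite setTI.
rewrite (_ : _ @^-1` B = \bigcup_(z : state N) (if `[< B (f z) >] then [set x | Y i x = z] else set0)).
  apply: countable_bigcupT_measurable => [|z]; first exact: countableP.
  by case: ifP.
apply/seteqP; split => [x Bx|x [z _]]; first by exists (Y i x); rewrite ?asboolT.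
by case: asboolP => [Bz /= ->|_ []].
Qed.
End trajectories.

Let hit x := hitting_time U C x.

Lemma expectation_hitting_time : (\int[P]_x hit x = (neg_time beta v)%:E)%E.
Proof.
have [Y [tau [[mY mtau] tau0 dvg Uy law]]] := process.
have mchi i := measurable_state_fun mY \1_(~` C) i.
have chi0 u : 0 <= \1_(~` C) u :> R by rewrite indicE.
pose Gn n x := \1_(~` C) (Y n x) * tau n x.
have mG n : measurable_fun setT (Gn n) by apply: measurable_funM.
have G0 n x : 0 <= Gn n x by rewrite mulr_ge0// ltW.
have FG n y : (\int[P]_(x in follow Y n y) (damping tau 0 n x * Gn n x)%:E =
    (path_weight (exit_rate G) (jump_prob G) v 0 n y * (\1_(~` C) (y n) / exit_rate G (y n)))%:E)%E.
  have mfol := measurable_follow mY n y.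
  have D0 x : (0 <= (damping tau 0 n x * tau n x)%:E)%E.
    by rewrite lee_fin mulr_ge0 ?damping_ge0// ltW.
  rewrite mulrCA EFinM -(integral_damping_time mY mtau tau0 exit_gt0 jump_ge0 law (lexx 0)).
  rewrite -ge0_integralZl_EFin//.
    by apply: eq_integral => x /set_mem xF; rewrite /Gn xF// -EFinM; congr (_%:E); ring.
  apply/measurable_EFinP; apply: measurable_funTS; apply: measurable_funM => //.
  exact: measurable_damping.
have E n : (\int[P]_x (survival Y \1_(~` C) 0 n x * Gn n x)%:E =
    (iter n (kill (move_prob beta) speak \1_(~` C)) (fun w => \1_(~` C) w / total_rate beta w) v)%:E)%E.
  have := integral_chain (theta := 0) (F := fun w => \1_(~` C) w / exit_rate G w) mY mtau tau0 law
    (fun u => undup_uniq _ : uniq (neighbors u)) sum_jump_prob1 chi0 mchi (mG n) (G0 n) (FG n).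
  rewrite step_kill.
  have -> : discount beta 0 = \1_(~` C) :> (state N -> R).
    by apply/funext => u; rewrite /discount addr0 divff ?mulr1// gt_eqF// total_rate_gt0.
  rewrite (_ : (fun w => \1_(~` C) w / exit_rate G w) =
    (fun w => \1_(~` C) w / total_rate beta w)); last first.
    by apply/funext => w; rewrite exit_rateE.
  move=> <-; apply: eq_integral => x _; rewrite /damping big1 ?mul1r// => i _.
  by rewrite mul0r oppr0 expR0.
under eq_integral => x _.
  rewrite /hit /hitting_time (hitting_time_series C (fun i => tau0 i x) (dvg x) (fun n t => Uy n x t)).
  over.
rewrite integral_nneseries//; last 2 first.
- move=> n; apply/measurable_EFinP; apply: measurable_funM; last exact: mG.
  by apply: measurable_prod => i _; exact: mchi.
- by move=> n x _; rewrite lee_fin mulr_ge0 ?G0// prodr_ge0.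
apply/cvg_lim => //.
pose u k := iter k (kill (move_prob beta) speak \1_(~` C))
  (fun w => \1_(~` C) w / total_rate beta w) v.
rewrite (_ : (fun n => _) = (fun n => (series u n)%:E)).
  by apply: cvg_EFin; [exact: nearW|exact: cvg_neg_time].
apply/funext => n; rewrite /series /= -sumEFin.
by apply: eq_bigr => i _; exact: E.
Qed.

Lemma measurable_exp_hitting_time theta :
  measurable_fun setT (fun x => exp_time theta (hit x)).
Proof.
have [Y [tau [[mY mtau] tau0 dvg Uy law]]] := process.
apply/measurable_EFinP.
rewrite (_ : EFin \o _ = (fun x => \sum_(0 <= n <oo)
  (\prod_(0 <= i < n) expR (- (theta * tau i x)) *
   (\prod_(0 <= i < n) \1_(~` C) (Y i x)) * \1_C (Y n x))%:E)%E).
  apply: ge0_emeasurable_sum => [n x _ _|n _].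
    by rewrite lee_fin !mulr_ge0 ?prodr_ge0// => i _; exact: expR_ge0.
  apply/measurable_EFinP; apply: measurable_funM; last exact: measurable_state_fun.
  apply: measurable_funM; first exact: (measurable_damping mtau).
  by apply: measurable_prod => i _; exact: measurable_state_fun.
apply/funext => x /=.
exact: (exp_time_series C (fun i => tau0 i x) (dvg x) (fun n t => Uy n x t)).
Qed.

Lemma laplace_hitting_time theta : 0 <= theta ->
  (\int[P]_x (exp_time theta (hit x))%:E = (neg_laplace beta theta v)%:E)%E.
Proof.
move=> theta0; have [Y [tau [[mY mtau] tau0 dvg Uy law]]] := process.
have mchi i := measurable_state_fun mY \1_(~` C) i.
have chi0 u : 0 <= \1_(~` C) u :> R by rewrite indicE.
pose Gn n x : R := \1_C (Y n x).
have mG n : measurable_fun setT (Gn n) by exact: measurable_state_fun.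
have G0 n x : 0 <= Gn n x by rewrite /Gn indicE.
have FG n y : (\int[P]_(x in follow Y n y) (damping tau theta n x * Gn n x)%:E =
    (path_weight (exit_rate G) (jump_prob G) v theta n y * \1_C (y n))%:E)%E.
  have mfol := measurable_follow mY n y.
  rewrite mulrC EFinM -(integral_damping mY mtau tau0 exit_gt0 jump_ge0 law theta0).
  rewrite -ge0_integralZl_EFin//.
  - by apply: eq_integral => x /set_mem xF; rewrite /Gn xF// -EFinM mulrC.
  - by move=> x _; rewrite lee_fin damping_ge0.
  - by apply/measurable_EFinP; apply: measurable_funTS; exact: measurable_damping.
have E n : (\int[P]_x (damping tau theta n x * survival Y \1_(~` C) 0 n x * Gn n x)%:E =
    (iter n (kill (move_prob beta) speak (discount beta theta)) \1_C v)%:E)%E.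
  rewrite -step_kill.
  exact: (integral_chain (theta := theta) (F := \1_C) mY mtau tau0 law
    (fun u => undup_uniq _ : uniq (neighbors u)) sum_jump_prob1 chi0 mchi (mG n) (G0 n) (FG n)).
under eq_integral => x _.
  rewrite /hit /hitting_time (exp_time_series C (fun i => tau0 i x) (dvg x) (fun n t => Uy n x t)).
  over.
rewrite integral_nneseries//; last 2 first.
- move=> n; apply/measurable_EFinP; apply: measurable_funM; last exact: mG.
  apply: measurable_funM; first exact: (measurable_damping mtau).
  by apply: measurable_prod => i _; exact: mchi.
- by move=> n x _; rewrite lee_fin !mulr_ge0 ?prodr_ge0// => i _; exact: expR_ge0.
apply/cvg_lim => //.
pose u k := iter k (kill (move_prob beta) speak (discount beta theta)) \1_C v.
rewrite (_ : (fun n => _) = (fun n => (series u n)%:E)).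
  by apply: cvg_EFin; [exact: nearW|exact: cvg_neg_laplace_series].
apply/funext => n; rewrite /series /= -sumEFin.
by apply: eq_bigr => i _; exact: E.
Qed.

End opinion_process.

(** * Convergence to the exponential law *)

Section exponential_cdf.
Context {R : realType}.

Lemma exponential_prob_cdf (r : R) :
  exponential_prob 1 `]-oo, r]%classic = (if 0 <= r then 1 - expR (- r) else 0)%:E.
Proof.
rewrite /exponential_prob.
have -> : (\int[lebesgue_measure]_(x in (`]-oo, r]%classic : set R)) (exponential_pdf 1 x)%:E =
    \int[lebesgue_measure]_(x in (`[0%R, r]%classic : set R)) (exponential_pdf 1 x)%:E)%E.
  rewrite integral_mkcond [RHS]integral_mkcond; apply: eq_integral => x _.
  have [x0|x0] := ltP x 0.
    rewrite !patchE lt0_exponential_pdf//; by do 2 case: ifP.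
  rewrite !patchE; congr (if _ then _ else _).
  by apply/idP/idP => /set_mem xA; apply/mem_set; move: xA; rewrite /= !in_itv/= x0.
have [r0|r0] := leP 0 r; last first.
  by rewrite set_itv_ge ?integral_set0// bnd_simp -ltNge.
move: r0; rewrite le_eqVlt => /predU1P[<-|r0].
  by rewrite set_itv1 integral_set1 oppr0 expR0 subrr.
have := exponential_prob_itv0c 1 r0; rewrite /exponential_prob => ->.
by rewrite mulN1r.
Qed.

End exponential_cdf.

Lemma exp_timeX {R : realType} (theta : R) (z : \bar R) k : (0 < k)%N ->
  exp_time theta z ^+ k = exp_time (k%:R * theta) z.
Proof.
case: z => [r||] k0 /=; rewrite ?expr0n ?gtn_eqF//.
by rewrite -expRM_natl -mulrA mulrN.
Qed.

Lemma exp_time01 {R : realType} (theta : R) (z : \bar R) :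
  0 <= theta -> (0 <= z)%E -> 0 <= exp_time theta z <= 1.
Proof.
move=> t0; case: z => [r||] //=; rewrite ?lexx ?ler01// lee_fin => r0.
by rewrite expR_ge0/= -[leRHS]expR0 ler_expR oppr_le0 mulr_ge0.
Qed.

Lemma le_exp_time {R : realType} (h r : R) (z : \bar R) : 0 < h ->
  (z * (h^-1)%:E <= r%:E)%E = (expR (- r) <= exp_time h^-1 z) || (z == -oo%E).
Proof.
move=> h0; case: z => [s||] /=.
- by rewrite -EFinM lee_fin ler_expR lerN2 mulrC orbF.
- by rewrite gt0_mulye ?lte_fin ?invr_gt0// leNgt ltry leNgt expR_gt0.
- by rewrite gt0_mulNye ?lte_fin ?invr_gt0// leNye orbT.
Qed.

Theorem theorem3 (R : realType) (N : nat) (N_ge3 : (3 <= N)%N)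
    (v : state N) (vC : consensus_pos v)
    (d : R -> measure_display) (T : forall beta : R, measurableType (d beta))
    (P : forall beta : R, probability (T beta) R)
    (U : forall beta : R, R -> T beta -> state N)
    (U_process : forall beta : R, 0 <= beta ->
       markov_jump_process (generator beta) v (P beta) (U beta)) :
  cvg_in_distribution (+oo%R : set_system R) P
    (fun beta (x : T beta) =>
       hitting_time (U beta) (@consensus_neg N) x /
       \int[P beta]_y hitting_time (U beta) (@consensus_neg N) y)%E
    (exponential_prob 1).
Proof.
move=> r _; rewrite exponential_prob_cdf.
pose hit (beta : R) (x : T beta) := hitting_time (U beta) (@consensus_neg N) x.
pose h (beta : R) : R := neg_time beta v.
pose a (beta : R) (x : T beta) : R := exp_time (h beta)^-1 (hit beta x).
have hit0 beta x : (0 <= hit beta x)%E.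
  by apply: le_ereal_inf_tmp => _ [t [t0 _] <-]; rewrite lee_fin ltW.
have h0 beta : 0 <= beta -> 0 < h beta by move=> b0; exact: neg_time_gt0.
have eventE beta : 0 <= beta ->
    [set x | (hit beta x / \int[P beta]_y hit beta y <= r%:E)%E] =
    ~` [set x | a beta x < expR (- r)].
  move=> b0; rewrite (expectation_hitting_time N_ge3 b0 (U_process _ b0)) -/(h beta).
  rewrite inver gt_eqF ?h0//; apply/seteqP.
  split=> x /=; rewrite le_exp_time ?h0//; have := hit0 beta x.
    by move=> hx /orP[|/eqP hE]; [rewrite leNgt => /negP|rewrite hE in hx].
  by move=> _ /negP; rewrite -leNgt => ->.
have a01 beta x : 0 <= beta -> 0 <= a beta x <= 1.
  by move=> b0; apply: exp_time01 => //; rewrite invr_ge0 ltW// h0.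
have ma beta : 0 <= beta -> measurable_fun setT (a beta).
  by move=> b0; exact: (measurable_exp_hitting_time (U_process _ b0)).
have b_ge0 : \forall beta \near +oo, (0 : R) <= beta by exact: nbhs_pinfty_ge.
have [r0|r0] := leP 0 r; last first.
  apply: (cvg_trans (near_eq_cvg (f := fun=> 0%:E) _)); last exact: cvg_cst.
  near=> beta; have b0 : 0 <= beta by near: beta.
  apply/esym; rewrite eventE// (_ : ~` _ = set0) ?measure0//.
  apply/seteqP; split=> // x /= /negP; rewrite -leNgt => ra.
  have /andP[_ a1] := a01 _ x b0.
  by have := le_trans ra a1; rewrite -[leRHS]expR0 ler_expR oppr_le0 leNgt r0.
(* The moments of a beta, that is of exp (- X) for the normalized hitting time X. *)
pose mu (beta : R) k : R := if k is 0%N then 1 else neg_laplace beta (k%:R / h beta) v.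
have muE beta k : 0 <= beta -> (\int[P beta]_x (a beta x ^+ k)%:E = (mu beta k)%:E)%E.
  move=> b0; case: k => [|k] /=.
    under eq_integral do rewrite expr0.
    by rewrite integral_cst// mul1e; exact: probability_setT.
  rewrite -(laplace_hitting_time N_ge3 b0 (U_process _ b0)); last first.
    by rewrite divr_ge0// ltW// h0.
  by apply: eq_integral => x _; rewrite exp_timeX.
have mu_cvg k : mu beta k @[beta --> +oo] --> (k.+1%:R^-1 : R).
  case: k => [|k] /=; first by rewrite invr1; exact: cvg_cst.
  have -> : k.+2%:R^-1 = (1 + k.+1%:R)^-1 :> R by rewrite [in RHS]addrC natr1.
  exact: (cvg_neg_laplace N_ge3 vC (ltr0Sn R k)).
pose c := expR (- r).
have c01 : 0 < c <= 1.
  by rewrite expR_gt0/= -[leRHS]expR0 ler_expR oppr_le0.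
pose F (beta : R) : R := fine (P beta [set x | a beta x < c]).
have F_cvg : F beta @[beta --> +oo] --> c.
  apply/cvgrPdist_le => e e0; have [n [delta delta0 hn]] := cdf_of_moments c01 e0.
  have mu_near : \forall beta \near +oo, forall k : 'I_n, `|mu beta k - k.+1%:R^-1| <= delta.
    apply: filter_forall => k; have /cvgrPdist_le/(_ _ delta0) := mu_cvg k.
    by apply: filterS => beta; rewrite distrC.
  near=> beta; have b0 : 0 <= beta by near: beta.
  rewrite distrC; apply: (hn _ _ (P beta) (a beta) (mu beta)) => //.
  - exact: ma.
  - by move=> x; exact: a01.
  - by move=> k; exact: muE.
  - move=> k kn; have mu_k : forall k : 'I_n, `|mu beta k - k.+1%:R^-1| <= delta by near: beta.
    exact: (mu_k (Ordinal kn)).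
apply: (cvg_trans (near_eq_cvg (f := fun beta => (1 - F beta)%:E) _)).
  near=> beta; have b0 : 0 <= beta by near: beta.
  rewrite eventE// probability_setC ?EFinB ?fineK//.
    by rewrite fin_num_measure//; apply: measurable_lt_cst; exact: ma.
  by apply: measurable_lt_cst; exact: ma.
apply: cvg_EFin; first exact: nearW.
by apply: cvgB F_cvg; exact: cvg_cst.
Unshelve. all: by end_near. Qed.
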